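(* Let $\gamma:[a,b]\to\mathbb{R}^3$ satisfy the following properties: (1) $\gamma$ is differentiable at each $t\in[a,b]$ and $\gamma'(t)\neq 0$, i.e., $\gamma$ is a regular curve; (2) for each $t_0\in\,]a,b[$, the function $\gamma$ is of class $C^n$ in a neighborhood of $t_0$, for some $n\ge 2$, and $\gamma^{(n)}(t_0)\neq 0$, but $\gamma^{(k)}(t_0)=0$ for $2\le k\le n-1$, if $n\ge 3$. Let $c:[0,L]\to\mathbb{R}^3$, $c(s):=\gamma(t(s))$, be the arc-length parameterization of $\gamma$, where $L$ is the length of $\gamma$ and $t(s)$ is the inverse of the function $s(t):=\int_a^t\|\gamma'(\lambda)\|\,d\lambda\in[0,L]$. Then the Frenet–Serret frame $(\mathfrak{t},\mathfrak{b},\mathfrak{n})$ is well-defined for each $s_0\in[0,L]$ by $$\mathfrak{t}(s_0):=\dot c(s_0),\qquad \mathfrak{b}(s_0):=\frac{\dot c(s_0)\times c^{(n)}(s_0)}{\|c^{(n)}(s_0)\|},\qquad \mathfrak{n}(s_0):=\mathfrak{b}(s_0)\times\mathfrak{t}(s_0)=\frac{c^{(n)}(s_0)}{\|c^{(n)}(s_0)\|},$$ where $s_0=s(t_0)$ and $n\ge 2$ is the integer given in (2) for $t_0$. Furthermore, $\ddot c(s_0)=0$ at a finite or countable set of points, and if $\ddot c(s_0)\neq 0$, then $\mathfrak{n}(s_0)=\ddot c(s_0)/\|\ddot c(s_0)\|$. Finally, $[\mathfrak{b}]$ and $[\mathfrak{n}]$ are continuous functions with values in $\mathbb{RP}^2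$.
   Context: Here $\times$ is the vector product in $\mathbb{R}^3$, $\|\cdot\|$ is the Euclidean norm, and $\dot c$, $\ddot c$, $c^{(k)}$ denote derivatives of $c$ with respect to the arc-length parameter $s$, while $\gamma'$, $\gamma^{(k)}$ denote derivatives of $\gamma$ with respect to its parameter $t$. The vectors $\mathfrak{t}$, $\mathfrak{b}$, $\mathfrak{n}$ are the tangent, the binormal and the principal normal. $\mathbb{RP}^2=\mathbb{S}^2/\{\pm1\}$ is the real projective plane, whose elements are denoted by $[y]$ for $y\in\mathbb{S}^2$, equipped with the metric $d_{\mathbb{RP}^2}([y],[z])=\min\{d_{\mathbb{S}^2}(y,z),d_{\mathbb{S}^2}(y,-z)\}$, where $d_{\mathbb{S}^2}$ is the geodesic distance on the unit sphere $\mathbb{S}^2\subset\mathbb{R}^3$.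
   Formalization: Added: γ'(t₀)×γ^(n)(t₀)≠0 in (2) (a straight line run at varying speed is otherwise a counterexample) and ‖γ'‖ integrable. At an endpoint, b and n are claimed only if (2) and this condition hold one-sidedly there, and the tangent only where γ' is continuous. *)

(* Defs.v *)
From HB Require Import structures.
From mathcomp Require Import all_boot all_order all_algebra generic_quotient.
From mathcomp Require Import all_classical all_reals all_analysis.

Set Implicit Arguments.
Unset Strict Implicit.
Unset Printing Implicit Defensive.

Import Order.TTheory GRing.Theory Num.Theory.
Import numFieldNormedType.Exports.

Local Open Scope classical_set_scope.
Local Open Scope ring_scope.
Local Open Scope quotient_scope.

(* The library norm on 'rV[R]_3 is the sup norm, hence these definitions; the
   library topology is the usual one, since all norms are equivalent. *)
Definition dotp (R : realType) (u v : 'rV[R]_3) : R := \sum_i u 0 i * v 0 i.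

Definition enorm (R : realType) (v : 'rV[R]_3) : R := Num.sqrt (dotp v v).

(* Indices are computed in 'I_3, i.e. modulo 3. *)
Definition cross (R : realType) (u v : 'rV[R]_3) : 'rV[R]_3 :=
  \row_(i < 3) (u 0 (i + 1) * v 0 (i + 2%:R) - u 0 (i + 2%:R) * v 0 (i + 1)).

(* Differentiation relative to a set A (always a closed interval below): the
   usual derivative at interior points, the one-sided one at the endpoints.
   Only values of f on A matter, and a derivative is a junk value at points
   where the corresponding [derivable_in] fails. *)
Definition derivable_in (R : realType) (A : set R) (f : R -> 'rV[R]_3) (x : R) :=
  cvg ((y - x)^-1 *: (f y - f x) @[y --> within A x^']).

Definition derive_in (R : realType) (A : set R) (f : R -> 'rV[R]_3) (x : R)
    : 'rV[R]_3 :=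
  lim ((y - x)^-1 *: (f y - f x) @[y --> within A x^']).

Definition derive_inn (R : realType) (A : set R) (n : nat) (f : R -> 'rV[R]_3)
    : R -> 'rV[R]_3 :=
  iter n (derive_in A) f.

Definition continuous_in_at (R : realType) (A : set R) (f : R -> 'rV[R]_3)
    (x : R) :=
  f y @[y --> within A (nbhs x)] --> f x.

(* f is of class C^n in a neighborhood of x relative to A. *)
Definition Cn_near (R : realType) (A : set R) (n : nat) (f : R -> 'rV[R]_3)
    (x : R) :=
  \forall y \near within A (nbhs x),
    (forall k, (k < n)%N -> derivable_in A (derive_inn A k f) y) /\
    continuous_in_at A (derive_inn A n f) y.

Definition order_at (R : realType) (a b : R) (gamma : R -> 'rV[R]_3)
    (t0 : R) (n : nat) :=
  [/\ (2 <= n)%N,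
      Cn_near `[a, b] n gamma t0,
      derive_inn `[a, b] n gamma t0 <> 0 &
      forall k, (2 <= k <= n.-1)%N -> derive_inn `[a, b] k gamma t0 = 0].

(* gamma^(n)(t0) is not parallel to gamma'(t0). Under [order_at a b gamma t0 n]
   this is equivalent to c^(n)(s0) <> 0, because c^(n)(s0) is then the component
   of gamma^(n)(t0) orthogonal to gamma'(t0), divided by |gamma'(t0)|^n. *)
Definition nonparallel_at (R : realType) (a b : R) (gamma : R -> 'rV[R]_3)
    (t0 : R) (n : nat) :=
  cross (derive_in `[a, b] gamma t0) (derive_inn `[a, b] n gamma t0) <> 0.

Definition speed (R : realType) (a b : R) (gamma : R -> 'rV[R]_3) (t : R) : R :=
  enorm (derive_in `[a, b] gamma t).

Definition arclen (R : realType) (a b : R) (gamma : R -> 'rV[R]_3) (t : R) : R :=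
  Rintegral lebesgue_measure `[a, t] (speed a b gamma).

Definition curve_length (R : realType) (a b : R) (gamma : R -> 'rV[R]_3) : R :=
  arclen a b gamma b.

Definition arclen_inv (R : realType) (a b : R) (gamma : R -> 'rV[R]_3)
    : R -> R :=
  'pinv_(fun=> a) `[a, b] (arclen a b gamma).

Definition arc_param (R : realType) (a b : R) (gamma : R -> 'rV[R]_3)
    : R -> 'rV[R]_3 :=
  gamma \o arclen_inv a b gamma.

(* c^(k), the k-th derivative of the arc-length parameterization on [0, L]. *)
Definition arc_derive (R : realType) (a b : R) (gamma : R -> 'rV[R]_3) (k : nat)
    : R -> 'rV[R]_3 :=
  derive_inn `[0, curve_length a b gamma] k (arc_param a b gamma).

(* The integer n of [order_at], which is unique when it exists. *)
Definition order_of (R : realType) (a b : R) (gamma : R -> 'rV[R]_3) (t0 : R)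
    : nat :=
  xget 0%N [set n | order_at a b gamma t0 n].

Definition tangent (R : realType) (a b : R) (gamma : R -> 'rV[R]_3) (s : R)
    : 'rV[R]_3 :=
  arc_derive a b gamma 1 s.

Definition binormal (R : realType) (a b : R) (gamma : R -> 'rV[R]_3) (s : R)
    : 'rV[R]_3 :=
  let n := order_of a b gamma (arclen_inv a b gamma s) in
  (enorm (arc_derive a b gamma n s))^-1 *:
    cross (arc_derive a b gamma 1 s) (arc_derive a b gamma n s).

Definition normal (R : realType) (a b : R) (gamma : R -> 'rV[R]_3) (s : R)
    : 'rV[R]_3 :=
  cross (binormal a b gamma s) (tangent a b gamma s).

(* The parameters at which the formulas for the binormal and the normal make
   sense. Endpoints belong to it only if gamma has an order there. *)
Definition frenet_dom (R : realType) (a b : R) (gamma : R -> 'rV[R]_3)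
    : set R :=
  [set s | s \in `[0, curve_length a b gamma] /\
     exists n, order_at a b gamma (arclen_inv a b gamma s) n /\
       nonparallel_at a b gamma (arclen_inv a b gamma s) n].

Definition orthonormal3 (R : realType) (u v w : 'rV[R]_3) :=
  [/\ enorm u = 1, enorm v = 1 & enorm w = 1] /\
  [/\ dotp u v = 0, dotp v w = 0 & dotp u w = 0].

Definition S2 (R : realType) : Type := {v : 'rV[R]_3 | enorm v == 1}.
HB.instance Definition _ (R : realType) := Choice.on (S2 R).

Definition antipodal (R : realType) : rel (S2 R) :=
  [rel y z : S2 R | (val y == val z) || (val y == - val z)].

Lemma antipodal_refl (R : realType) : reflexive (@antipodal R).
Proof. by move=> y; rewrite /antipodal /= eqxx. Qed.

Lemma antipodal_sym (R : realType) : symmetric (@antipodal R).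
Proof.
by move=> y z; rewrite /antipodal /= eq_sym [in X in _ || X]eq_sym eqr_oppLR.
Qed.

Lemma antipodal_trans (R : realType) : transitive (@antipodal R).
Proof.
move=> y x z /orP[] /eqP xy /orP[] /eqP yz;
  by rewrite /antipodal /= xy yz ?opprK eqxx ?orbT.
Qed.

Canonical antipodal_equiv (R : realType) :=
  EquivRel (@antipodal R) (@antipodal_refl R) (@antipodal_sym R)
    (@antipodal_trans R).

Definition RP2 (R : realType) : Type := {eq_quot (antipodal_equiv R)}.

(* The geodesic distance of two points of the unit sphere is their angle. *)
Definition dS2 (R : realType) (y z : 'rV[R]_3) : R := acos (dotp y z).

Definition dRP2 (R : realType) (p q : RP2 R) : R :=
  Num.min (dS2 (val (repr p)) (val (repr q)))
          (dS2 (val (repr p)) (- val (repr q))).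

Lemma dotpNl (R : realType) (u v : 'rV[R]_3) : dotp (- u) v = - dotp u v.
Proof. by rewrite /dotp -sumrN; apply: eq_bigr => i _; rewrite mxE mulNr. Qed.

Lemma dotpNr (R : realType) (u v : 'rV[R]_3) : dotp u (- v) = - dotp u v.
Proof. by rewrite /dotp -sumrN; apply: eq_bigr => i _; rewrite mxE mulrN. Qed.

Lemma dRP2_pi (R : realType) (y z : S2 R) :
  dRP2 (\pi_(RP2 R) y) (\pi_(RP2 R) z) =
  Num.min (dS2 (val y) (val z)) (dS2 (val y) (- val z)).
Proof.
have rep (x : S2 R) : antipodal (repr (\pi_(RP2 R) x)) x.
  by have := reprK (\pi_(RP2 R) x) => /eqmodP.
rewrite /dRP2 /dS2.
by case/orP: (rep y) => /eqP ->; case/orP: (rep z) => /eqP ->;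
  rewrite ?(dotpNl, dotpNr, opprK) // minC.
Qed.

Lemma enorm_delta (R : realType) : enorm (delta_mx 0 0 : 'rV[R]_3) == 1.
Proof.
rewrite /enorm /dotp big_ord_recl big1 ?addr0 => [|i _].
  by rewrite !mxE /= mulr1 sqrtr1.
by rewrite !mxE /= mulr0.
Qed.

(* The class [v]; for v not on the unit sphere it is an arbitrary point. *)
Definition rp2 (R : realType) (v : 'rV[R]_3) : RP2 R :=
  \pi_(RP2 R) (insubd (Sub (delta_mx 0 0) (enorm_delta R) : S2 R) v).

Definition rp2_continuous_on (R : realType) (D : set R) (F : R -> RP2 R) :=
  forall s0, D s0 ->
    dRP2 (F s) (F s0) @[s --> within D (nbhs s0)] --> (0 : R).

(* Main.v *)
Require Import Defs.
From mathcomp Require Import all_boot all_order all_algebra.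
From mathcomp Require Import all_classical all_reals all_analysis.
From mathcomp Require Import ring lra.

Import Order.TTheory GRing.Theory Num.Theory.
Import numFieldNormedType.Exports.

Local Open Scope classical_set_scope.
Local Open Scope ring_scope.

(** The speed |gamma'| is positive and integrable, so the arc length s(t) is a
    continuous increasing bijection, with a continuous inverse t(s).  Wherever
    gamma' is continuous the derivative of s is |gamma'|, whence
    c' = (gamma' / |gamma'|) o t.  More generally (g o t)' = (g' / |gamma'|) o t,
    and 1 / |gamma'| is as smooth as gamma'; an induction on the class of g then
    shows that c is of class C^n near every point where gamma is ([Ck_comp]).

    The derivatives of c at a point s0 = s(t0) of order n are found without
    expanding the higher derivatives of a composition.  Taylor's formula gives
      gamma'(t) - gamma'(t0) = (t - t0)^(n-1) (p + o(1)),
      p = gamma^(n)(t0) / (n-1)!.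
    The map x |-> x / |x| is differentiable at x0 = gamma'(t0), and its
    differential is the orthogonal projection along x0, divided by |x0|
    ([normalize_asymp]).  Hence c'(s) - c'(s0) = (s - s0)^(n-1) (q + o(1)), with q
    the component of p orthogonal to x0, divided by |x0|^n.  A function of class
    C^(n-1) has only one such expansion ([peano_unique]), so that c^(k)(s0) = 0
    for 2 <= k < n, while c^(n)(s0) = (n-1)! q ([reparam_order]).  This vector is
    orthogonal to the tangent, and it is nonzero exactly when gamma^(n)(t0) is not
    parallel to gamma'(t0).  The formulas for the frame are then vector algebra
    ([frame_algebra]).

    Applied to c, Taylor's formula also says that
      c''(s) = (s - s0)^(n-2) (c^(n)(s0) / (n-2)! + o(1)).
    So c'' has no zero in a punctured neighborhood of s0: its zeros in ]0, L[ are
    isolated, hence countably many.  At a point where c'' is nonzero the order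
    is 2, since a higher order would make c'' vanish.  Therefore the normal near
    s0 is the direction of c''(s), which tends to the normal at s0 up to the sign
    of (s - s0)^(n-2), and the binormal behaves likewise.  This sign is invisible
    in the projective plane ([rp2_continuous_at]).

    All limits are taken relative to a closed interval, so that the endpoints are
    treated together with the interior points. *)

(** * Scalar derivatives relative to a set *)

Section RelativeDerivative.
Context {R : realType}.
Implicit Types (A O : set R) (f g : R -> R) (x y l m : R).

(** The scalar counterpart of [derive_in], as a relation between a function and
    its derivative: calculus is done coordinate by coordinate. *)
Definition der_in A f x l :=
  (y - x)^-1 * (f y - f x) @[y --> within A x^'] --> l.

Lemma near_within A (x : R) (P : R -> Prop) : A x ->
  P x -> (\forall y \near within A x^', P y) ->
  \forall y \near within A (nbhs x), P y.
Proof.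
move=> Ax Px; rewrite !near_withinE => dP.
apply: filterS dP => y yP Ay.
by have [->//|yx] := eqVneq y x; apply: yP.
Qed.

Lemma near_dwithin A (x : R) (P : R -> Prop) :
  (\forall y \near within A (nbhs x), P y) ->
  \forall y \near within A x^', P y.
Proof.
rewrite !near_withinE => dP.
by apply: filterS dP => y yP _.
Qed.

Lemma near_dwithinT A (x : R) : \forall y \near within A x^', A y /\ y != x.
Proof. by rewrite !near_withinE; apply: filterE. Qed.

Lemma cvg_dwithin A (T : topologicalType) (F : R -> T) (x : R) (z : T) :
  F y @[y --> within A (nbhs x)] --> z ->
  F y @[y --> within A x^'] --> z.
Proof. by move=> Fz P /Fz; apply: near_dwithin. Qed.

Lemma cvg_within_pt A (T : topologicalType) (F : R -> T) (x : R) : A x ->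
  F y @[y --> within A x^'] --> F x ->
  F y @[y --> within A (nbhs x)] --> F x.
Proof.
move=> Ax Fx P PF; apply: (@near_within A x (fun y => P (F y))) => //.
  exact: nbhs_singleton PF.
exact: Fx.
Qed.

Lemma eq_cvg_dwithin A (T : topologicalType) (F G : R -> T) (x : R) (z : T) :
  (forall y, A y -> y != x -> F y = G y) ->
  F y @[y --> within A x^'] --> z -> G y @[y --> within A x^'] --> z.
Proof.
move=> FG; apply: cvg_trans; apply: near_eq_cvg.
by apply: filterS (near_dwithinT A x) => y [Ay yx]; apply: FG.
Qed.

Lemma cvg_sub_dwithin A (x : R) : (y - x) @[y --> within A x^'] --> (0 : R).
Proof.
rewrite -(subrr x); apply: cvgB; last exact: cvg_cst.
by apply: cvg_dwithin; apply: cvg_within.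
Qed.

Lemma der_in_cont {A f x l} : A x -> der_in A f x l ->
  f y @[y --> within A (nbhs x)] --> f x.
Proof.
move=> Ax fl; apply: cvg_within_pt => //.
rewrite -[f x in X in _ --> X](addr0 (f x)) -[X in _ --> _ + X](mul0r l).
apply: (@eq_cvg_dwithin _ _ (fun y => f x + (y - x) * ((y - x)^-1 * (f y - f x)))).
  by move=> y _ yx; rewrite mulVKf ?subr_eq0// addrC subrK.
apply: cvgD; first exact: cvg_cst.
exact: (cvgM (cvg_sub_dwithin A x) fl).
Qed.

Lemma der_in_near {A f g x l} : f x = g x ->
  (\forall y \near within A (nbhs x), f y = g y) ->
  der_in A f x l -> der_in A g x l.
Proof.
move=> fgx fg; rewrite /der_in -fgx; apply: cvg_trans; apply: near_eq_cvg.
by apply: near_dwithin; apply: filterS fg => y ->.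
Qed.

Lemma open_near_within {A O x} (P : R -> Prop) : open O -> O x ->
  (forall y, A y -> O y -> P y) -> \forall y \near within A (nbhs x), P y.
Proof.
move=> oO Ox h; rewrite near_withinE; have := open_nbhs_nbhs (conj oO Ox).
by apply: filterS => y Oy Ay; apply: h.
Qed.

Lemma der_in_ext {A O f g x l} : open O -> A x -> O x ->
  (forall y, A y -> O y -> f y = g y) -> der_in A f x l -> der_in A g x l.
Proof.
move=> oO Ax Ox fg; apply: der_in_near; first exact: fg.
exact: (open_near_within _ oO Ox fg).
Qed.

Lemma der_in_cst A x l : der_in A (cst l) x 0.
Proof.
apply: (@eq_cvg_dwithin _ _ (cst 0)); last exact: cvg_cst.
by move=> y _ _; rewrite /= subrr mulr0.
Qed.

Lemma der_in_id A x : der_in A idfun x 1.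
Proof.
apply: (@eq_cvg_dwithin _ _ (cst (1 : R))); last exact: cvg_cst.
by move=> y _ yx; rewrite /= mulVf// subr_eq0.
Qed.

Lemma der_inD {A f g x l m} : der_in A f x l -> der_in A g x m ->
  der_in A (fun y => f y + g y) x (l + m).
Proof.
move=> fl gm; apply: eq_cvg_dwithin (cvgD fl gm) => y _ _ /=.
by ring.
Qed.

Lemma der_inM {A f g x l m} : A x -> der_in A f x l -> der_in A g x m ->
  der_in A (fun y => f y * g y) x (l * g x + f x * m).
Proof.
move=> Ax fl gm; have gc := cvg_dwithin _ _ _ _ _ (der_in_cont Ax gm).
apply: (@eq_cvg_dwithin _ _ (fun y => ((y - x)^-1 * (f y - f x)) * g y +
    f x * ((y - x)^-1 * (g y - g x)))); first by move=> y _ _; ring.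
apply: cvgD; first exact: cvgM.
by apply: cvgM => //; exact: cvg_cst.
Qed.

(** One over the square root is the only nonlinear function applied to
    coordinates: for f = |gamma'|^2 it gives the reciprocal of the speed.  Its
    derivative is a polynomial in itself and f', which is what makes the
    induction of [CkVsqrt] work. *)
Lemma der_inVsqrt {A f x l} : A x -> (forall y, A y -> 0 < f y) ->
  der_in A f x l ->
  der_in A (fun y => (Num.sqrt (f y))^-1) x
    (- 2^-1 * (Num.sqrt (f x))^-1 ^+ 3 * l).
Proof.
move=> Ax f0 fl; have fc := cvg_dwithin _ _ _ _ _ (der_in_cont Ax fl).
have sc : Num.sqrt (f y) @[y --> within A x^'] --> Num.sqrt (f x).
  exact: continuous_cvg (@sqrt_continuous R (f x)) fc.
have s0 y : A y -> 0 < Num.sqrt (f y) by move=> Ay; rewrite sqrtr_gt0 f0.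
have d0 : Num.sqrt (f x) * Num.sqrt (f x) * (Num.sqrt (f x) + Num.sqrt (f x)) != 0.
  by rewrite gt_eqF// !mulr_gt0 ?addr_gt0 ?s0.
have -> : - 2^-1 * (Num.sqrt (f x))^-1 ^+ 3 * l = - l *
    (Num.sqrt (f x) * Num.sqrt (f x) * (Num.sqrt (f x) + Num.sqrt (f x)))^-1.
  by have sx := s0 _ Ax; field; rewrite !gt_eqF//= addr_gt0.
apply: (@eq_cvg_dwithin _ _ (fun y => - ((y - x)^-1 * (f y - f x)) *
    (Num.sqrt (f x) * Num.sqrt (f y) * (Num.sqrt (f y) + Num.sqrt (f x)))^-1)).
  move=> y Ay yx.
  have -> : f y - f x = Num.sqrt (f y) ^+ 2 - Num.sqrt (f x) ^+ 2.
    by rewrite !sqr_sqrtr// ltW ?f0.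
  have [sx sy] := (s0 _ Ax, s0 _ Ay).
  by field; rewrite subr_eq0 yx !gt_eqF//= addr_gt0.
apply: cvgM; first exact: cvgN.
apply: cvgV => //; apply: cvgM; first by apply: cvgM => //; exact: cvg_cst.
by apply: cvgD => //; exact: cvg_cst.
Qed.

End RelativeDerivative.

(** * Functions of class C^k and the chain rule *)

Section Smooth.
Context {R : realType}.
Implicit Types (A B O : set R) (f g : R -> R) (x y l m : R).

(** Class C^k at the points of A lying in O, with derivatives relative to A.
    The successive derivatives are existentially quantified, so that closure
    under the operations is proved by plain induction on k. *)
Fixpoint Ck A O (k : nat) f : Prop :=
  if k is k'.+1 then
    exists2 f', (forall x, A x -> O x -> der_in A f x (f' x)) & Ck A O k' f'
  else forall x, A x -> O x -> f y @[y --> within A (nbhs x)] --> f x.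

Lemma Ck_ext {A O k f g} : open O ->
  (forall x, A x -> O x -> f x = g x) -> Ck A O k f -> Ck A O k g.
Proof.
move=> oO fg; case: k => [|k] /= fk.
  move=> x Ax Ox; rewrite -fg//; apply: cvg_trans (fk x Ax Ox).
  by apply: near_eq_cvg; exact: (open_near_within _ oO Ox fg).
case: fk => f' ff' f'k; exists f' => // x Ax Ox.
by apply: (der_in_ext oO Ax Ox fg); exact: ff'.
Qed.

Lemma CkW {A O k f} : Ck A O k.+1 f -> Ck A O k f.
Proof.
elim: k f => [|k IH] f [f' ff' f'k].
  by move=> x Ax Ox; apply: der_in_cont (ff' x Ax Ox).
by exists f' => //; exact: IH.
Qed.

Lemma Ck_cst {A O k} l : Ck A O k (cst l).
Proof.
elim: k l => [|k IH] l; first by move=> x Ax Ox; exact: cvg_cst.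
by exists (cst 0) => // x _ _; exact: der_in_cst.
Qed.

Lemma CkD {A O k f g} : Ck A O k f -> Ck A O k g ->
  Ck A O k (fun y => f y + g y).
Proof.
elim: k f g => [|k IH] f g.
  by move=> fk gk x Ax Ox; apply: cvgD; [exact: fk|exact: gk].
move=> [f' ff' fk] [g' gg' gk]; exists (fun y => f' y + g' y); last exact: IH.
by move=> x Ax Ox; apply: der_inD; [exact: ff'|exact: gg'].
Qed.

Lemma CkM {A O k f g} : Ck A O k f -> Ck A O k g ->
  Ck A O k (fun y => f y * g y).
Proof.
elim: k f g => [|k IH] f g.
  by move=> fk gk x Ax Ox; apply: cvgM; [exact: fk|exact: gk].
move=> Cf Cg; have [fk' gk'] := (CkW Cf, CkW Cg).
move: Cf Cg => [f' ff' fk] [g' gg' gk].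
exists (fun y => f' y * g y + f y * g' y); last by apply: CkD; exact: IH.
by move=> x Ax Ox; apply: der_inM => //; [exact: ff'|exact: gg'].
Qed.

Lemma Ck_sum {A O k} {I : finType} (F : I -> R -> R) :
  (forall i, Ck A O k (F i)) -> Ck A O k (fun y => \sum_i F i y).
Proof.
move=> Fk; rewrite (_ : (fun y => _) = \sum_i F i); last first.
  by apply/funext => y; rewrite fct_sumE.
by elim/big_ind : _ => //; [exact: Ck_cst|move=> f g; exact: CkD].
Qed.

Lemma CkVsqrt {A O k f} : (forall y, A y -> 0 < f y) -> Ck A O k f ->
  Ck A O k (fun y => (Num.sqrt (f y))^-1).
Proof.
move=> f0; elim: k f f0 => [|k IH] f f0.
  move=> fk x Ax Ox; apply: cvgV; first by rewrite gt_eqF// sqrtr_gt0 f0.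
  by apply: continuous_cvg; [exact: sqrt_continuous|exact: fk].
move=> Cf; have wk := IH _ f0 (CkW Cf); case: Cf => f' ff' f'k.
exists (fun y => - 2^-1 * (Num.sqrt (f y))^-1 ^+ 3 * f' y).
  by move=> x Ax Ox; apply: der_inVsqrt => //; exact: ff'.
apply: CkM => //; apply: CkM; first exact: Ck_cst.
by rewrite /GRing.exp /=; do 2 (apply: CkM => //).
Qed.

(** The inverse tau is injective, so it never takes the value tau x away from
    x: this is what allows punctured limits to be composed with it. *)
Lemma cvg_dwithin_comp {A B} (sg tau : R -> R) {x} :
  B x -> (forall y, B y -> A (tau y) /\ sg (tau y) = y) ->
  tau y @[y --> within B (nbhs x)] --> tau x ->
  tau y @[y --> within B x^'] --> within A (tau x)^'.
Proof.
move=> Bx st tc P AP.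
have AP' : nbhs (tau x) (fun z => z != tau x -> A z -> P z) := AP.
have := cvg_dwithin _ _ _ _ _ tc _ AP'; apply: filterS2 (near_dwithinT B x).
move=> y [By yx]; apply; last exact: (st _ By).1.
by apply: contra_neq yx => /(congr1 sg); rewrite (st _ By).2 (st _ Bx).2.
Qed.

(** The chain rule and the rule for inverse functions at once: the difference
    quotient of g o tau at x is that of g at tau x divided by that of sg. *)
Lemma der_in_chain {A B g} (sg tau : R -> R) {x l} v :
  B x -> (forall y, B y -> A (tau y) /\ sg (tau y) = y) ->
  tau y @[y --> within B (nbhs x)] --> tau x ->
  der_in A sg (tau x) v -> v != 0 ->
  der_in A g (tau x) l -> der_in B (g \o tau) x (v^-1 * l).
Proof.
move=> Bx st tc sgv v0 gl; have tc' := cvg_dwithin_comp sg tau Bx st tc.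
apply: (@eq_cvg_dwithin _ _ _ (fun y =>
    ((tau y - tau x)^-1 * (sg (tau y) - sg (tau x)))^-1 *
    ((tau y - tau x)^-1 * (g (tau y) - g (tau x))))); last first.
  apply: cvgM; first by apply: cvgV => //; exact: cvg_comp tc' sgv.
  exact: cvg_comp tc' gl.
move=> y By yx; have tyx : tau y - tau x != 0.
  rewrite subr_eq0; apply: contra_neq yx => /(congr1 sg).
  by rewrite (st _ By).2 (st _ Bx).2.
by rewrite (st _ By).2 (st _ Bx).2 /=; field; rewrite tyx subr_eq0 yx.
Qed.

(** With w = 1 / sg', the derivative of g o tau is (w g') o tau; as w g' is again
    smooth, the induction on k goes through and loses no derivative. *)
Lemma Ck_comp {A B O O' k g} (sg tau w : R -> R) :
  (forall y, B y -> A (tau y) /\ sg (tau y) = y) ->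
  (forall x, B x -> tau y @[y --> within B (nbhs x)] --> tau x) ->
  (forall x, B x -> O' x -> O (tau x)) ->
  (forall x, A x -> O x -> w x != 0 /\ der_in A sg x (w x)^-1) ->
  Ck A O k.-1 w -> Ck A O k g -> Ck B O' k (g \o tau).
Proof.
move=> st tc OO dw; elim: k g => [|k IH] g wk.
  move=> gk x Bx Ox; apply: (@cvg_comp _ _ _ tau g _ (within A (nbhs (tau x)))).
    move=> P AP; have AP' : nbhs (tau x) (fun z => A z -> P z) := AP.
    have BT : within B (nbhs x) B by exact: withinT.
    apply: filterS2 BT (tc _ Bx _ AP') => y By AtP.
    exact: AtP (st _ By).1.
  by apply: gk; [exact: (st _ Bx).1|exact: OO].
move=> [g' gg' g'k]; exists ((fun y => w y * g' y) \o tau).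
  move=> x Bx Ox; have [Ax Oy] := ((st _ Bx).1, OO _ Bx Ox).
  have [w0 dsg] := dw _ Ax Oy.
  rewrite /= -[w _ in X in der_in _ _ _ X]invrK.
  apply: (@der_in_chain A B _ sg tau) => //; first exact: (tc _ Bx).
    by rewrite invr_eq0.
  exact: gg'.
apply: IH; last exact: CkM.
by case: k wk {g'k} => // k; exact: CkW.
Qed.

Lemma der_in_is_derive {A f x l} : A° x -> der_in A f x l -> is_derive x 1 f l.
Proof.
move=> Aox fl.
have h : (fun h => h^-1 *: ((f \o shift x) (h *: 1) - f x)) @ 0^' --> l.
  have sh : (fun h : R => h + x) @ 0^' --> within A x^'.
    move=> P AP; have AP' : nbhs x (fun z => z != x -> A z -> P z) := AP.
    have : \forall y \near x, y != x -> P y.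
      by apply: filterS2 AP' Aox => y; auto.
    have s0 : (h + x) @[h --> (0 : R)] --> (0 + x : R).
      apply: cvgD; first exact: cvg_id.
      exact: cvg_cst.
    rewrite add0r in s0 => /s0 Q0.
    change (nbhs (0 : R) (fun h => h != 0 -> P (h + x))).
    have Q1 : nbhs (0 : R) (fun h => h + x != x -> P (h + x)) := Q0.
    apply: filterS Q1 => h Q h0.
    by apply: Q; rewrite -subr_eq0 addrK.
  have := cvg_comp _ _ sh fl; apply: cvg_trans; apply: near_eq_cvg; near=> h.
  by rewrite /= /GRing.scale /= mulr1 addrK.
by split; [apply/cvg_ex; exists l|exact: cvg_lim].
Unshelve. all: by end_near. Qed.

End Smooth.

(** * Peano's form of Taylor's theorem on a segment *)

Section Taylor.
Context {R : realType} {a b : R} (hab : a < b).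
Local Notation A := (`[a, b]%classic : set R).
Implicit Types (O : set R) (f g : R -> R) (x y l m : R).

(** Derivatives relative to a segment are unique, at endpoints included,
    because no point of the segment is isolated in it. *)
Lemma dwithin_proper x : x \in `[a, b] -> ProperFilter (within A x^').
Proof.
have ab := hab; rewrite in_itv /= => /andP[ax xb]; apply: Build_ProperFilter_ex => P P0.
have /nbhs_ballP[e /= e0 eP] : nbhs x (fun y => y != x -> A y -> P y) := P0.
have [xltb|bx] := ltP x b.
  exists (Num.min (x + e / 2) b); have lt1 : x < Num.min (x + e / 2) b.
    by rewrite lt_min xltb andbT; lra.
  apply: eP; last 2 first.
  - by rewrite gt_eqF.
  - by rewrite /= in_itv /= ge_min lexx orbT andbT; lra.
  rewrite /ball /= distrC gtr0_norm ?subr_gt0//.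
  by rewrite ltrBlDl gt_min; apply/orP; left; lra.
exists (Num.max (x - e / 2) a); have lt1 : Num.max (x - e / 2) a < x.
  by rewrite gt_max; apply/andP; split; lra.
apply: eP; last 2 first.
- by rewrite lt_eqF.
- by rewrite /= in_itv /= le_max lexx orbT /=; lra.
rewrite /ball /= gtr0_norm ?subr_gt0//.
by rewrite ltrBlDl -ltrBlDr lt_max; apply/orP; left; lra.
Qed.

Lemma dwithin_cvg_unique {x} {f : R -> R} {l m : R} : x \in `[a, b] ->
  f y @[y --> within A x^'] --> l -> f y @[y --> within A x^'] --> m -> l = m.
Proof.
move=> Ax fl fm; have PF := dwithin_proper x Ax.
by apply: (cvg_unique _ fl fm); exact: norm_hausdorff.
Qed.

Lemma ooitv_interior x : a < x < b -> A° x.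
Proof.
move=> /andP[ax xb]; have : x \in `]a, b[ by rewrite in_itv /= ax.
move=> /near_in_itvoo; apply: filterS.
  by move=> y; rewrite /= !in_itv /= => /andP[ay yb]; rewrite (ltW ay) (ltW yb).
Qed.

(** Inside the segment the relative derivative is the usual one, so the mean
    value theorems apply on every subsegment. *)
Lemma der_in_segment {f O df u v} : a <= u -> v <= b ->
  (forall y, u <= y <= v -> O y) ->
  (forall y, A y -> O y -> der_in A f y (df y)) ->
  {within `[u, v], continuous f} /\
  (forall y, y \in `]u, v[ -> is_derive y 1 f (df y)).
Proof.
move=> au vb uvO dfy; have uvA y : u <= y <= v -> A y.
  by move=> /andP[uy yv]; rewrite /= in_itv /= (le_trans au)//= (le_trans yv).
split.
  apply/subspace_continuousP => y; rewrite /= in_itv /= => uyv.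
  have := der_in_cont (uvA _ uyv) (dfy _ (uvA _ uyv) (uvO _ uyv)).
  apply: cvg_trans; apply: cvg_app; apply: within_subset => z /=.
  by rewrite in_itv; exact: uvA.
move=> y; rewrite in_itv /= => /andP[uy yv].
apply: (@der_in_is_derive _ A).
  by apply: ooitv_interior; rewrite (le_lt_trans au)//= (lt_le_trans yv).
by apply: dfy; [apply: uvA|apply: uvO]; rewrite !ltW.
Qed.

Lemma dwithin_ball {x} {P : R -> Prop} :
  (\forall y \near within A x^', P y) ->
  exists2 e, 0 < e & forall y, A y -> y != x -> `|x - y| < e -> P y.
Proof.
move=> xP; have /nbhs_ballP[e /= e0 eP] :
  nbhs x (fun y => y != x -> A y -> P y) := xP.
by exists e => // y Ay yx xye; exact: eP.
Qed.

Lemma ball_dwithin {x} {P : R -> Prop} e : 0 < e ->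
  (forall y, A y -> y != x -> `|x - y| < e -> P y) ->
  \forall y \near within A x^', P y.
Proof.
move=> e0 eP; change (nbhs x (fun y => y != x -> A y -> P y)).
by apply/nbhs_ballP; exists e => //= y xye yx Ay; exact: eP.
Qed.

(** Cauchy's mean value theorem for f and (y - x0)^(m+1), on either side
    of x0: it trades one power of y - x0 for one derivative of f. *)
Lemma mvt_pow {f df O x0 y} (m : nat) : x0 \in `[a, b] -> y \in `[a, b] -> y != x0 ->
  (forall z, `|x0 - z| <= `|x0 - y| -> O z) ->
  (forall z, A z -> O z -> der_in A f z (df z)) -> f x0 = 0 ->
  exists2 z, [/\ A z, z != x0 & `|x0 - z| < `|x0 - y|] &
    f y / (y - x0) ^+ m.+1 = df z / (m.+1%:R * (z - x0) ^+ m).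
Proof.
rewrite !in_itv /= => /andP[ax xb] /andP[ay yb] yx bO dfz fx0.
have dpow (z : R) : is_derive z (1 : R) (fun z : R => (z - x0) ^+ m.+1)
    (m.+1%:R * (z - x0) ^+ m).
  have d1 : is_derive z (1 : R) (fun z : R => z - x0) 1.
    by apply: is_derive_eq; rewrite subr0.
  rewrite (_ : (fun z => _) = (fun z : R => z - x0) ^+ m.+1); last first.
    by rewrite exprfctE.
  apply: is_derive_eq.
  by rewrite /GRing.scale /= mulr1.
have pow0 z : z != x0 -> m.+1%:R * (z - x0) ^+ m != 0 :> R.
  by move=> zx; rewrite mulf_neq0 ?pnatr_eq0// expf_neq0// subr_eq0.
have cpow u v : {within `[u, v], continuous (fun z : R => (z - x0) ^+ m.+1)}.
  apply: continuous_subspaceT => z.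
  by apply/differentiable_continuous/derivable1_diffP; exact: ex_derive.
have [yx0|x0y|/eqP] := ltgtP y x0; last by rewrite (negPf yx).
  have O1 z : y <= z <= x0 -> O z.
    by move=> /andP[? ?]; apply: bO; rewrite !ger0_norm; lra.
  have [cf df'] := der_in_segment ay xb O1 dfz.
  have dg0 z : z \in `]y, x0[ -> m.+1%:R * (z - x0) ^+ m != 0 :> R.
    by rewrite in_itv /= => /andP[_ zx]; rewrite pow0// lt_eqF.
  have [z + e] := cauchy_MVT yx0 cf (cpow _ _) df' (fun z _ => dpow z) dg0.
  rewrite in_itv /= => /andP[yz zx]; exists z.
    by rewrite in_itv /= (lt_eqF zx) !gtr0_norm ?subr_gt0//; split => //; lra.
  rewrite e fx0 subrr expr0n /= !sub0r; have : (y - x0) ^+ m.+1 != 0.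
    by rewrite expf_neq0// subr_eq0.
  by move=> ?; field.
have O1 z : x0 <= z <= y -> O z.
  move=> /andP[? ?]; apply: bO.
  by rewrite (distrC x0 z) (distrC x0 y) !ger0_norm; lra.
have [cf df'] := der_in_segment ax yb O1 dfz.
have dg0 z : z \in `]x0, y[ -> m.+1%:R * (z - x0) ^+ m != 0 :> R.
  by rewrite in_itv /= => /andP[xz _]; rewrite pow0// gt_eqF.
have [z + e] := cauchy_MVT x0y cf (cpow _ _) df' (fun z _ => dpow z) dg0.
rewrite in_itv /= => /andP[yz zx]; exists z.
  rewrite in_itv /= (gt_eqF yz) (distrC x0 z) (distrC x0 y) !gtr0_norm ?subr_gt0//.
  by split => //; lra.
by rewrite e fx0 subrr expr0n /= !subr0.
Qed.

(** By induction on m: [mvt_pow] reduces the quotient of d 0 by the power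
    m + 1 to the quotient of d 1 by the power m. *)
Lemma peano {d : nat -> R -> R} {O} {m : nat} {x0} : open O -> x0 \in `[a, b] -> O x0 ->
  (forall k, (k < m)%N -> forall y, A y -> O y -> der_in A (d k) y (d k.+1 y)) ->
  d m y @[y --> within A (nbhs x0)] --> d m x0 ->
  (forall k, (k < m)%N -> d k x0 = 0) ->
  d 0%N y / (y - x0) ^+ m @[y --> within A x0^'] --> d m x0 / m`!%:R.
Proof.
move=> oO Ax Ox; elim: m d => [|m IH] d dd dc d0.
  rewrite fact0 divr1.
  apply: eq_cvg_dwithin (cvg_dwithin _ _ _ _ _ dc) => y _ _.
  by rewrite expr0 divr1.
have := IH (fun k => d k.+1) (fun k km => dd k.+1 km) dc (fun k km => d0 k.+1 km).
move=> dl; apply/cvgrPdist_lt => e e0.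
have /nbhs_ballP[r /= r0 rO] := open_nbhs_nbhs (conj oO Ox).
have [r' r'0 r'P] := dwithin_ball ((@cvgrPdist_lt _ _ _ _ _ _ _).1 dl e e0).
apply: (@ball_dwithin _ _ (Num.min r r')); first by rewrite lt_min r0.
move=> y Ay yx; rewrite lt_min => /andP[yr yr'].
have bO z : `|x0 - z| <= `|x0 - y| -> O z.
  by move=> zy; apply: rO; exact: le_lt_trans yr.
have [z [Az zx xzy] ->] := mvt_pow m Ax Ay yx bO (dd 0%N isT) (d0 0%N isT).
have := r'P z Az zx (lt_trans xzy yr').
rewrite factS natrM => h; rewrite !invfM.
have -> : d m.+1 x0 * (m.+1%:R^-1 * (m`!)%:R^-1) -
     d 1%N z * (m.+1%:R^-1 * ((z - x0) ^+ m)^-1) =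
   m.+1%:R^-1 * (d m.+1 x0 / m`!%:R - d 1%N z / (z - x0) ^+ m) by ring.
rewrite normrM ger0_norm ?invr_ge0//; apply: le_lt_trans h.
by rewrite ler_piMl// invf_le1 ?ltr0n// ler1n.
Qed.

(** If k is the first index with d k x0 <> 0 and k < m, then [peano] gives a
    nonzero limit for d 0 y / (y - x0)^k, whereas the hypothesis on the power m
    forces this limit to be 0. *)
Lemma peano_unique {d : nat -> R -> R} {O} {m : nat} {x0} {q : R} :
  open O -> x0 \in `[a, b] -> O x0 ->
  (forall k, (k < m)%N -> forall y, A y -> O y -> der_in A (d k) y (d k.+1 y)) ->
  d m y @[y --> within A (nbhs x0)] --> d m x0 ->
  d 0%N x0 = 0 ->
  d 0%N y / (y - x0) ^+ m @[y --> within A x0^'] --> q ->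
  (forall k, (k < m)%N -> d k x0 = 0) /\ d m x0 = m`!%:R * q.
Proof.
move=> oO Ax Ox dd dc d00 dq.
have d0 k : (k < m)%N -> d k x0 = 0.
  elim/ltn_ind: k => k IH km; have dk : forall j, (j < k)%N -> d j x0 = 0.
    by move=> j jk; apply: IH => //; exact: ltn_trans km.
  have dkc := der_in_cont Ax (dd k km x0 Ax Ox).
  have h1 := peano oO Ax Ox (fun j jk => dd j (ltn_trans jk km)) dkc dk.
  have h2 : d 0%N y / (y - x0) ^+ k @[y --> within A x0^'] --> q * 0 ^+ (m - k).
    apply: (@eq_cvg_dwithin _ _ _
        (fun y => d 0%N y / (y - x0) ^+ m * (y - x0) ^+ (m - k))).
      move=> y _ yx; rewrite -{1}(subnKC (ltnW km)) exprD invfM mulrA mulfVK//.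
      by rewrite expf_neq0// subr_eq0.
    apply: cvgM => //.
    exact: continuous_cvg (@exprn_continuous R (m - k) 0) (cvg_sub_dwithin A x0).
  have := dwithin_cvg_unique Ax h1 h2.
  rewrite expr0n subn_eq0 leqNgt km mulr0 => /eqP.
  by rewrite mulf_eq0 invr_eq0 pnatr_eq0 (gtn_eqF (fact_gt0 k)) orbF => /eqP.
split => //; have h1 := peano oO Ax Ox dd dc d0.
have <- := dwithin_cvg_unique Ax h1 dq.
by rewrite mulrC divfK// pnatr_eq0 -lt0n fact_gt0.
Qed.

End Taylor.

(** * Vectors in three dimensions *)

Section VectorAlgebra.
Context {R : realType}.
Implicit Types (u v w z : 'rV[R]_3) (k : R).

Let o0 : 'I_3 := ord0.
Let o1 : 'I_3 := Ordinal (isT : (1 < 3)%N).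
Let o2 : 'I_3 := Ordinal (isT : (2 < 3)%N).

Lemma row3P u v :
  u 0 o0 = v 0 o0 -> u 0 o1 = v 0 o1 -> u 0 o2 = v 0 o2 -> u = v.
Proof.
move=> h0 h1 h2; apply/rowP => -[[|[|[|//]]] p].
- by rewrite (_ : Ordinal p = o0)//; apply/val_inj.
- by rewrite (_ : Ordinal p = o1)//; apply/val_inj.
- by rewrite (_ : Ordinal p = o2)//; apply/val_inj.
Qed.

Lemma dotpE u v : dotp u v = u 0 o0 * v 0 o0 + u 0 o1 * v 0 o1 + u 0 o2 * v 0 o2.
Proof.
rewrite /dotp 3!big_ord_recl big_ord0 addr0 addrA.
by congr (_ + _ * _ + _ * _); congr (fun_of_matrix _ _ _); apply/val_inj.
Qed.

Lemma crossE u v :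
  [/\ cross u v 0 o0 = u 0 o1 * v 0 o2 - u 0 o2 * v 0 o1,
      cross u v 0 o1 = u 0 o2 * v 0 o0 - u 0 o0 * v 0 o2 &
      cross u v 0 o2 = u 0 o0 * v 0 o1 - u 0 o1 * v 0 o0].
Proof.
have e1 : o0 + 1 = o1 by apply/val_inj.
have e2 : o0 + 2%:R = o2 by apply/val_inj.
have e3 : o1 + 1 = o2 by apply/val_inj.
have e4 : o1 + 2%:R = o0 by apply/val_inj.
have e5 : o2 + 1 = o0 by apply/val_inj.
have e6 : o2 + 2%:R = o1 by apply/val_inj.
by split; rewrite mxE ?(e1, e2, e3, e4, e5, e6).
Qed.

Let cE0 u v := let: And3 h _ _ := crossE u v in h.
Let cE1 u v := let: And3 _ h _ := crossE u v in h.
Let cE2 u v := let: And3 _ _ h := crossE u v in h.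
Let E := (cE0, cE1, cE2, dotpE, mxE).

Lemma dotpC u v : dotp u v = dotp v u.
Proof. by rewrite !E; ring. Qed.

Lemma dotpDl u v w : dotp (u + v) w = dotp u w + dotp v w.
Proof. by rewrite !E; ring. Qed.

Lemma dotpZl k u v : dotp (k *: u) v = k * dotp u v.
Proof. by rewrite !E; ring. Qed.

Lemma dotpZr k u v : dotp u (k *: v) = k * dotp u v.
Proof. by rewrite !E; ring. Qed.

Lemma dotpBl u v w : dotp (u - v) w = dotp u w - dotp v w.
Proof. by rewrite !E; ring. Qed.

(** The Binet-Cauchy identity, which yields both the norm of a vector product
    and the Cauchy-Schwarz inequality. *)
Lemma dotp_cross u v w z :
  dotp (cross u v) (cross w z) = dotp u w * dotp v z - dotp u z * dotp v w.
Proof. by rewrite !E; ring. Qed.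

Lemma crossK u v : cross (cross u v) u = dotp u u *: v - dotp u v *: u.
Proof. by apply: row3P; rewrite !E; ring. Qed.

Lemma dotp_crossl u v : dotp u (cross u v) = 0.
Proof. by rewrite !E; ring. Qed.

Lemma dotp_crossr u v : dotp (cross u v) v = 0.
Proof. by rewrite !E; ring. Qed.

Lemma crossZl k u v : cross (k *: u) v = k *: cross u v.
Proof. by apply: row3P; rewrite !E; ring. Qed.

Lemma crossZr k u v : cross u (k *: v) = k *: cross u v.
Proof. by apply: row3P; rewrite !E; ring. Qed.

Lemma crossBZ k u v : cross u (v - k *: u) = cross u v.
Proof. by apply: row3P; rewrite !E; ring. Qed.

Lemma dotpvv_ge0 u : 0 <= dotp u u.
Proof. by rewrite /dotp sumr_ge0// => i _; rewrite -expr2 sqr_ge0. Qed.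

Lemma dotpvv_gt0 u : u != 0 -> 0 < dotp u u.
Proof.
move=> u0; rewrite lt_neqAle dotpvv_ge0 andbT eq_sym.
apply: contra u0; rewrite /dotp psumr_eq0 => [/allP h|i _]; last first.
  by rewrite -expr2 sqr_ge0.
apply/eqP/rowP => i; have := h i (mem_index_enum _).
by rewrite mulf_eq0 orbb mxE => /eqP.
Qed.

Lemma enorm_gt0 u : u != 0 -> 0 < enorm u.
Proof. by move=> u0; rewrite sqrtr_gt0 dotpvv_gt0. Qed.

Lemma sqr_enorm u : enorm u ^+ 2 = dotp u u.
Proof. by rewrite sqr_sqrtr// dotpvv_ge0. Qed.

Lemma enormZ k u : enorm (k *: u) = `|k| * enorm u.
Proof. by rewrite /enorm dotpZl dotpZr mulrA -expr2 sqrtrM ?sqr_ge0// sqrtr_sqr. Qed.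

Lemma enorm_normalize u : u != 0 -> enorm ((enorm u)^-1 *: u) = 1.
Proof.
by move=> /enorm_gt0 u0; rewrite enormZ ger0_norm ?invr_ge0 ?ltW// mulVf// gt_eqF.
Qed.

Lemma enorm_cross u v : dotp u v = 0 -> enorm (cross u v) = enorm u * enorm v.
Proof.
by move=> uv; rewrite {1}/enorm dotp_cross uv mul0r subr0 sqrtrM// dotpvv_ge0.
Qed.

Lemma norm_dotp_le1 u v : enorm u = 1 -> enorm v = 1 -> `|dotp u v| <= 1.
Proof.
move=> u1 v1; have := dotpvv_ge0 (cross u v).
rewrite dotp_cross -!sqr_enorm u1 v1 (dotpC v u) !expr1n mulr1 -expr2 subr_ge0.
by rewrite -real_normK ?num_real// -[leRHS](expr1n _ 2) ler_pXn2r// nnegrE.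
Qed.

End VectorAlgebra.

Section VectorCalculus.
Context {R : realType}.
Implicit Types (f : R -> 'rV[R]_3).

Lemma cvg_rowP {T : Type} (F : set_system T) (FF : Filter F)
    (f : T -> 'rV[R]_3) (v : 'rV[R]_3) :
  f x @[x --> F] --> v <-> forall i, f x 0 i @[x --> F] --> v 0 i.
Proof.
split=> [fv i|fv].
  exact: (cvg_comp _ _ fv (@coord_continuous R _ _ 0 i v)).
apply/cvgrPdist_le => e e0; have fv' i : \forall x \near F, `|v 0 i - f x 0 i| <= e.
  by move: (fv i) => /cvgrPdist_le; apply.
have := @filter_forall T _ (fun i => [set x | `|v 0 i - f x 0 i| <= e]) F FF fv'.
apply: filterS => x h; rewrite /Num.norm /= mx_normrE; apply/bigmax_leP.
split; first exact: ltW.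
by move=> [i j] _ /=; rewrite !mxE (ord1 i); exact: h.
Qed.

Lemma cvg_dotp {T : Type} {F : set_system T} {FF : Filter F}
    (f g : T -> 'rV[R]_3) (u v : 'rV[R]_3) :
  f x @[x --> F] --> u -> g x @[x --> F] --> v ->
  dotp (f x) (g x) @[x --> F] --> dotp u v.
Proof.
move=> /cvg_rowP fu /cvg_rowP gv; apply: cvg_big => [|i _]; last exact: cvgM.
exact: add_continuous.
Qed.

Lemma cvg_enorm {T : Type} {F : set_system T} {FF : Filter F}
    (f : T -> 'rV[R]_3) (u : 'rV[R]_3) :
  f x @[x --> F] --> u -> enorm (f x) @[x --> F] --> enorm u.
Proof.
move=> fu; have uu : dotp (f x) (f x) @[x --> F] --> dotp u u by exact: cvg_dotp.
by rewrite /enorm; exact: continuous_cvg (@sqrt_continuous R (dotp u u)) uu.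
Qed.

Lemma cvg_cross {T : Type} {F : set_system T} {FF : Filter F}
    (f g : T -> 'rV[R]_3) (u v : 'rV[R]_3) :
  f x @[x --> F] --> u -> g x @[x --> F] --> v ->
  cross (f x) (g x) @[x --> F] --> cross u v.
Proof.
move=> /cvg_rowP fu /cvg_rowP gv; apply/cvg_rowP => i; rewrite mxE.
rewrite (_ : (fun x => _) = fun x =>
  f x 0 (i + 1) * g x 0 (i + 2%:R) - f x 0 (i + 2%:R) * g x 0 (i + 1)).
  by apply: cvgB; apply: cvgM.
by apply/funext => x; rewrite mxE.
Qed.

Context {a b : R} (hab : a < b).
Local Notation A := (`[a, b]%classic : set R).

Lemma derive_in_coord {f x} {l : 'rV[R]_3} : x \in `[a, b] ->
  (forall i, der_in A (fun y => f y 0 i) x (l 0 i)) ->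
  derivable_in A f x /\ derive_in A f x = l.
Proof.
move=> Ax fl; have PF := dwithin_proper hab x Ax.
have h : (y - x)^-1 *: (f y - f x) @[y --> within A x^'] --> l.
  apply/cvg_rowP => i; apply: eq_cvg_dwithin (fl i) => y _ _.
  by rewrite !mxE.
split; first by apply/cvg_ex; exists l.
by apply: cvg_lim => //; exact: norm_hausdorff.
Qed.

Lemma derivable_in_coord {f x} : derivable_in A f x ->
  forall i, der_in A (fun y => f y 0 i) x (derive_in A f x 0 i).
Proof.
move=> /cvg_rowP h i; apply: eq_cvg_dwithin (h i) => y _ _.
by rewrite !mxE.
Qed.

(** The condition of [Cn_near] on a fixed open set instead of a germ of
    neighborhoods. *)
Definition Cn_on (O : set R) (n : nat) f := forall y, A y -> O y ->
  (forall k, (k < n)%N -> derivable_in A (derive_inn A k f) y) /\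
  continuous_in_at A (derive_inn A n f) y.

Lemma derive_innS f k : derive_inn A k.+1 f = derive_inn A k (derive_in A f).
Proof. by rewrite /derive_inn iterSr. Qed.

Lemma Cn_onP {O n f} : open O ->
  Cn_on O n f <-> forall i, Ck A O n (fun y => f y 0 i).
Proof.
move=> oO; elim: n f => [|n IH] f.
  split=> [h i y Ay Oy|h y Ay Oy].
    by have [_ /cvg_rowP] := h y Ay Oy; apply.
  by split=> //; apply/cvg_rowP => i; exact: h.
split=> [h i|h].
  exists (fun y => derive_in A f y 0 i).
    by move=> y Ay Oy; apply: derivable_in_coord; exact: (h y Ay Oy).1 0%N _.
  apply: (IH _).1 => y Ay Oy; have [h1 h2] := h y Ay Oy; split.
    by move=> k kn; rewrite -derive_innS; exact: h1.
  by rewrite -derive_innS.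
have /choice[f' f'P] : forall i, exists f'i,
    (forall y, A y -> O y -> der_in A (fun y => f y 0 i) y (f'i y)) /\
    Ck A O n f'i.
  by move=> i; have [f' ? ?] := h i; exists f'.
pose F' y : 'rV[R]_3 := \row_i f' i y.
have dF y : A y -> O y -> derivable_in A f y /\ derive_in A f y = F' y.
  move=> Ay Oy; apply: derive_in_coord => // i; rewrite mxE.
  exact: (f'P i).1.
have : Cn_on O n (derive_in A f).
  apply/IH => i; apply: (Ck_ext oO _ (f'P i).2) => y Ay Oy.
  by rewrite (dF _ Ay Oy).2 mxE.
move=> h1 y Ay Oy; have [h2 h3] := h1 y Ay Oy; rewrite derive_innS; split => //.
move=> [|k] kn; first exact: (dF _ Ay Oy).1.
by rewrite derive_innS; exact: h2.
Qed.

Lemma Cn_on_near {n f x} : Cn_near A n f x <->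
  exists U, [/\ open U, U x & Cn_on U n f].
Proof.
split=> [h|[U [oU Ux h]]].
  have : nbhs x (fun y => A y ->
    (forall k, (k < n)%N -> derivable_in A (derive_inn A k f) y) /\
    continuous_in_at A (derive_inn A n f) y) := h.
  rewrite nbhsE => -[U [oU Ux] UP]; exists U; split => //.
  by move=> y Ay Uy; exact: UP.
by apply: (open_near_within _ oU Ux) => y Ay Uy; exact: h.
Qed.

End VectorCalculus.

(** * Derivatives of the arc-length parametrization at a point of order n *)

Section Jets.
Context {R : realType} {a b : R} (hab : a < b).
Local Notation A := (`[a, b]%classic : set R).
Implicit Types (f : R -> 'rV[R]_3) (U : set R).

Lemma cvg_row_scale {B x} (k : R -> R) (f : R -> 'rV[R]_3) (l : R)
    (v : 'rV[R]_3) :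
  (forall i, f y 0 i * k y @[y --> within B x^'] --> v 0 i * l) ->
  k y *: f y @[y --> within B x^'] --> l *: v.
Proof.
move=> h; apply/cvg_rowP => i; rewrite mxE mulrC.
by apply: eq_cvg_dwithin (h i) => y _ _; rewrite mxE mulrC.
Qed.

Lemma Cn_on_derive {U n f} : @Cn_on R a b U n.+1 f ->
  @Cn_on R a b U n (derive_in A f).
Proof.
move=> h y Ay Oy; have [h1 h2] := h y Ay Oy; split.
  by move=> k kn; rewrite -derive_innS; exact: h1.
by rewrite -derive_innS.
Qed.

Lemma Cn_on_continuous {U n f k y} : @Cn_on R a b U n f -> A y -> U y ->
  (k <= n)%N -> continuous_in_at A (derive_inn A k f) y.
Proof.
move=> h Ay Uy; rewrite leq_eqVlt => /predU1P[->|kn]; first exact: (h y Ay Uy).2.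
apply/cvg_rowP => i.
exact: der_in_cont Ay (derivable_in_coord ((h y Ay Uy).1 k kn) i).
Qed.

(** The successive derivatives of the i-th coordinate of f' - f'(x0); the
    constant f'(x0) is only felt by the zeroth one. *)
Definition velocity_jet f (x0 : R) (i : 'I_3) (k : nat) (y : R) : R :=
  derive_inn A k.+1 f y 0 i + (if k is 0%N then - derive_in A f x0 0 i else 0).

Lemma velocity_jet_der {U n f x0 i k y} : @Cn_on R a b U n f ->
  A y -> U y -> (k.+1 < n)%N ->
  der_in A (velocity_jet f x0 i k) y (velocity_jet f x0 i k.+1 y).
Proof.
move=> h Ay Uy kn; apply: der_inD; last first.
  by case: k kn => [|k] _; exact: der_in_cst.
exact: derivable_in_coord ((h y Ay Uy).1 k.+1 kn) i.
Qed.

Lemma velocity_jet_cont {U n f x0 i k y} : @Cn_on R a b U n f ->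
  A y -> U y -> (k.+1 <= n)%N ->
  velocity_jet f x0 i k z @[z --> within A (nbhs y)] --> velocity_jet f x0 i k y.
Proof.
move=> h Ay Uy kn; apply: cvgD; last exact: cvg_cst.
by have /cvg_rowP := Cn_on_continuous h Ay Uy kn; apply.
Qed.

Lemma velocity_jet0 f x0 i : velocity_jet f x0 i 0 x0 = 0.
Proof. by rewrite /velocity_jet subrr. Qed.

Lemma velocity_jetS f x0 i k y :
  velocity_jet f x0 i k.+1 y = derive_inn A k.+2 f y 0 i.
Proof. by rewrite /velocity_jet addr0. Qed.

Lemma velocity_peano {U n f x0} : open U -> A x0 -> U x0 ->
  @Cn_on R a b U n.+2 f ->
  (forall k, (2 <= k <= n.+1)%N -> derive_inn A k f x0 = 0) ->
  ((y - x0) ^+ n.+1)^-1 *: (derive_in A f y - derive_in A f x0)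
    @[y --> within A x0^'] --> (n.+1)`!%:R^-1 *: derive_inn A n.+2 f x0.
Proof.
move=> oU Ax Ux h f0; apply/cvg_rowP => i.
have := @peano R a b (velocity_jet f x0 i) U n.+1 x0 oU Ax Ux.
rewrite velocity_jetS !mxE mulrC => pe.
apply: eq_cvg_dwithin (pe _ _ _).
- by move=> y _ _; rewrite !mxE mulrC.
- by move=> k kn y Ay Uy; exact: (velocity_jet_der h).
- by rewrite -(velocity_jetS f x0); exact: (velocity_jet_cont h).
case=> [|k] kn; first exact: velocity_jet0.
by rewrite velocity_jetS f0 ?mxE.
Qed.

Lemma velocity_peano_unique {U n f x0} {q : 'rV[R]_3} : open U -> A x0 -> U x0 ->
  @Cn_on R a b U n.+2 f ->
  ((y - x0) ^+ n.+1)^-1 *: (derive_in A f y - derive_in A f x0)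
    @[y --> within A x0^'] --> q ->
  (forall k, (2 <= k <= n.+1)%N -> derive_inn A k f x0 = 0) /\
  derive_inn A n.+2 f x0 = (n.+1)`!%:R *: q.
Proof.
move=> oU Ax Ux h /cvg_rowP fq.
have H i : (forall k, (k < n.+1)%N -> velocity_jet f x0 i k x0 = 0) /\
    velocity_jet f x0 i n.+1 x0 = (n.+1)`!%:R * q 0 i.
  apply: (peano_unique hab oU Ax Ux).
  - by move=> k kn y Ay Uy; exact: (velocity_jet_der h).
  - exact: (velocity_jet_cont h).
  - exact: velocity_jet0.
  - by apply: eq_cvg_dwithin (fq i) => y _ _; rewrite !mxE mulrC.
split; last by apply/rowP => i; rewrite mxE -(H i).2 velocity_jetS.
move=> [|[|k]]// /andP[_ kn]; apply/rowP => i.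
by rewrite -(velocity_jetS f x0) (H i).1// mxE.
Qed.

Lemma acceleration_peano {U n f x0} : open U -> A x0 -> U x0 ->
  @Cn_on R a b U n.+2 f ->
  (forall k, (2 <= k <= n.+1)%N -> derive_inn A k f x0 = 0) ->
  ((y - x0) ^+ n)^-1 *: derive_inn A 2 f y
    @[y --> within A x0^'] --> n`!%:R^-1 *: derive_inn A n.+2 f x0.
Proof.
move=> oU Ax Ux h f0; apply: cvg_row_scale => i.
have pe : derive_inn A 2 f y 0 i / (y - x0) ^+ n @[y --> within A x0^'] -->
    derive_inn A n.+2 f x0 0 i / n`!%:R.
  apply: (@peano R a b (fun k y => derive_inn A k.+2 f y 0 i) U n x0 oU Ax Ux).
  - move=> k kn y Ay Uy.
    exact: (derivable_in_coord ((h y Ay Uy).1 k.+2 kn) i).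
  - by have /cvg_rowP := (h x0 Ax Ux).2; apply.
  - by move=> k kn; rewrite f0 ?mxE.
exact: pe.
Qed.

End Jets.

Section Normalization.
Context {R : realType}.
Implicit Types (x p : 'rV[R]_3) (g : R -> 'rV[R]_3).

(** Exact first order expansion of x |-> x / |x|, obtained from
    |x|^2 - |x0|^2 = <x - x0, x + x0>. *)
Lemma normalize_sub (k : R) x x0 : x != 0 -> x0 != 0 ->
  k *: ((enorm x)^-1 *: x - (enorm x0)^-1 *: x0) =
  (enorm x)^-1 *: (k *: (x - x0)) - (dotp (k *: (x - x0)) (x + x0) *
     ((enorm x + enorm x0) * enorm x * enorm x0)^-1) *: x0.
Proof.
move=> /enorm_gt0 rgt0 /enorm_gt0 r0gt0.
have -> : dotp (k *: (x - x0)) (x + x0) = k * (enorm x ^+ 2 - enorm x0 ^+ 2).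
  rewrite !sqr_enorm dotpZl dotpBl 2!(dotpC _ (_ + _)) !dotpDl (dotpC x0).
  by ring.
apply/rowP => i; rewrite !mxE; move: (enorm x) rgt0 (enorm x0) r0gt0 => r r_gt0 r0 r0_gt0.
by field; rewrite !gt_eqF ?addr_gt0.
Qed.

(** The scaling k t plays the part of (t - t0)^(1-n).  In [normalize_sub] the
    coefficients depend continuously on x, so the limit is obtained by replacing
    g t with g t0 everywhere but in the scaled difference. *)
Lemma normalize_asymp {A : set R} {t0 : R} {k : R -> R} {g p} : A t0 ->
  (forall t, A t -> g t != 0) ->
  g t @[t --> within A (nbhs t0)] --> g t0 ->
  k t *: (g t - g t0) @[t --> within A t0^'] --> p ->
  k t *: ((enorm (g t))^-1 *: g t - (enorm (g t0))^-1 *: g t0)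
    @[t --> within A t0^'] -->
  (enorm (g t0))^-1 *: (p - (dotp p (g t0) / enorm (g t0) ^+ 2) *: g t0).
Proof.
move=> At0 g0 gc gp; have gc' := cvg_dwithin _ _ _ _ _ gc.
apply: (@eq_cvg_dwithin _ _ _ (fun t =>
   (enorm (g t))^-1 *: (k t *: (g t - g t0)) -
   (dotp (k t *: (g t - g t0)) (g t + g t0) *
   ((enorm (g t) + enorm (g t0)) * enorm (g t) * enorm (g t0))^-1) *: g t0)).
  by move=> t At _; rewrite normalize_sub// g0.
have gn : enorm (g t) @[t --> within A t0^'] --> enorm (g t0) by exact: cvg_enorm.
have r00 : 0 < enorm (g t0) by rewrite enorm_gt0// g0.
move: (g t0) r00 gp gc' gn => x0 r00 gp gc' gn.
have -> : (enorm x0)^-1 *: (p - (dotp p x0 / enorm x0 ^+ 2) *: x0) =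
  (enorm x0)^-1 *: p - (dotp p (x0 + x0) *
    ((enorm x0 + enorm x0) * enorm x0 * enorm x0)^-1) *: x0.
  apply/rowP => i; rewrite !mxE (dotpC p (_ + _)) dotpDl (dotpC p).
  by field; rewrite !gt_eqF ?addr_gt0.
apply: cvgB.
  by apply: cvgZ => //; apply: cvgV => //; rewrite gt_eqF.
apply: cvgZ; last exact: cvg_cst.
apply: cvgM.
  by apply: cvg_dotp => //; apply: cvgD => //; exact: cvg_cst.
apply: cvgV; first by rewrite gt_eqF// !mulr_gt0// addr_gt0.
apply: cvgM; last exact: cvg_cst.
by apply: cvgM => //; apply: cvgD => //; exact: cvg_cst.
Qed.

End Normalization.

Section Reparametrization.
Context {R : realType} {a b L : R} (hab : a < b) (hL : 0 < L).
Local Notation A := (`[a, b]%classic : set R).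
Local Notation B := (`[0, L]%classic : set R).
Context (gamma : R -> 'rV[R]_3) (sg tau : R -> R).
Local Notation gamma' := (derive_in A gamma).
Local Notation c := (gamma \o tau).
Hypothesis hreg : forall t, A t -> derivable_in A gamma t /\ gamma' t <> 0.
Hypothesis tauP : forall s, B s -> A (tau s) /\ sg (tau s) = s.
Hypothesis tauC : forall s, B s -> tau y @[y --> within B (nbhs s)] --> tau s.
Hypothesis sgD : forall t, A t -> continuous_in_at A gamma' t ->
  der_in A sg t (enorm (gamma' t)).

Definition unit_velocity t := (enorm (gamma' t))^-1 *: gamma' t.

Lemma enorm_velocity_gt0 t : A t -> 0 < enorm (gamma' t).
Proof. by move=> At; apply: enorm_gt0; apply/eqP; exact: (hreg t At).2. Qed.

Lemma enorm_unit_velocity t : A t -> enorm (unit_velocity t) = 1.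
Proof. by move=> At; apply: enorm_normalize; apply/eqP; exact: (hreg t At).2. Qed.

Lemma derive_arc_param s : B s -> continuous_in_at A gamma' (tau s) ->
  derivable_in B c s /\ derive_in B c s = unit_velocity (tau s).
Proof.
move=> Bs gc; have At := (tauP s Bs).1.
apply: (derive_in_coord hL) => // i; rewrite mxE.
apply: (@der_in_chain _ A B (fun t => gamma t 0 i) sg tau s) => //.
- exact: (tauC s Bs).
- exact: (sgD _ At gc).
- by rewrite gt_eqF// enorm_velocity_gt0.
exact: derivable_in_coord (hreg _ At).1 i.
Qed.

Lemma Cn_on_arc_param {U U' n} : open U -> open U' ->
  (forall s, B s -> U' s -> U (tau s)) ->
  @Cn_on R a b U n.+1 gamma -> @Cn_on R 0 L U' n.+1 c.
Proof.
move=> oU oU' UU h; apply/(Cn_onP hL oU') => i.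
apply: (@Ck_comp _ A B U U' n.+1 (fun t => gamma t 0 i) sg tau
  (fun t => (enorm (gamma' t))^-1)) => //.
- move=> t At Ut; rewrite invr_eq0 invrK gt_eqF ?enorm_velocity_gt0//; split => //.
  by apply: sgD => //; exact: (Cn_on_continuous h At Ut (isT : (1 <= n.+1)%N)).
- have /(Cn_onP hab oU) g'k := Cn_on_derive h.
  apply: (Ck_ext oU (f := fun t => (Num.sqrt (\sum_i gamma' t 0 i * gamma' t 0 i))^-1)).
    by [].
  apply: CkVsqrt; last by apply: Ck_sum => j; exact: CkM.
  by move=> t At; apply: dotpvv_gt0; apply/eqP; exact: (hreg t At).2.
by move: i; apply/(Cn_onP hab oU).
Qed.

Lemma unit_velocity_asymp (m : nat) t0 (p : 'rV[R]_3) :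
  A t0 -> continuous_in_at A gamma' t0 ->
  ((t - t0) ^+ m)^-1 *: (gamma' t - gamma' t0) @[t --> within A t0^'] --> p ->
  ((t - t0) ^+ m)^-1 *: (unit_velocity t - unit_velocity t0)
    @[t --> within A t0^'] -->
  (enorm (gamma' t0))^-1 *:
    (p - (dotp p (gamma' t0) / enorm (gamma' t0) ^+ 2) *: gamma' t0).
Proof.
move=> At0; apply: normalize_asymp => // t At.
by apply/eqP; exact: (hreg t At).2.
Qed.

Lemma scale_projection (f r : R) (u x : 'rV[R]_3) n : f != 0 ->
  f *: (r^-1 ^+ n *: (r^-1 *: (f^-1 *: u - (dotp (f^-1 *: u) x / r ^+ 2) *: x))) =
  r^-1 ^+ n.+1 *: (u - (dotp u x / r ^+ 2) *: x).
Proof.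
move=> f0; rewrite dotpZl -mulrA -scalerA -scalerBr !scalerA; congr (_ *: _).
by rewrite exprSr; move: (r^-1) => q; field.
Qed.

(** Substituting t = tau s in an asymptotic expansion multiplies its
    coefficient by the m-th power of the derivative of tau. *)
Lemma velocity_asymp_chain {U} {s0 : R} {m : nat} {r : R} {p : 'rV[R]_3} :
  open U -> B s0 -> U s0 ->
  (forall s, B s -> U s -> derive_in B c s = unit_velocity (tau s)) ->
  der_in B tau s0 r ->
  ((tau s - tau s0) ^+ m)^-1 *: (unit_velocity (tau s) - unit_velocity (tau s0))
    @[s --> within B s0^'] --> p ->
  ((s - s0) ^+ m)^-1 *: (derive_in B c s - derive_in B c s0)
    @[s --> within B s0^'] --> r ^+ m *: p.
Proof.
move=> oU Bs0 Us0 c' dtau asy.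
have nU : \forall s \near within B s0^', U s.
  by apply: near_dwithin; apply: (open_near_within _ oU Us0) => y _.
have : ((s - s0)^-1 * (tau s - tau s0)) ^+ m *: (((tau s - tau s0) ^+ m)^-1 *:
    (unit_velocity (tau s) - unit_velocity (tau s0)))
    @[s --> within B s0^'] --> r ^+ m *: p.
  apply: cvgZ => //.
  exact: continuous_cvg (@exprn_continuous R m r) dtau.
apply: cvg_trans; apply: near_eq_cvg.
apply: filterS2 nU (near_dwithinT B s0) => s Us [Bs ss0] /=.
rewrite (c' s Bs Us) (c' s0 Bs0 Us0) scalerA exprMn exprVn -mulrA divff ?mulr1//.
have ts : tau s != tau s0.
  apply: contra_neq ss0 => /(congr1 sg).
  by rewrite (tauP _ Bs).2 (tauP _ Bs0).2.
by rewrite expf_neq0// subr_eq0.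
Qed.

(** Reparametrization by arc length keeps the derivatives of order 2 to n-1 equal
    to 0 and turns gamma^(n) into a multiple of its component orthogonal to the
    velocity.  The asymptotics of gamma' are
    pushed through the normalization, then through the substitution t = tau s,
    and read back as derivatives by uniqueness of Taylor expansions. *)
Lemma reparam_order s0 n : B s0 -> order_at a b gamma (tau s0) n ->
  let x0 := gamma' (tau s0) in let gn := derive_inn A n gamma (tau s0) in
  exists U, [/\ open U, U s0, @Cn_on R 0 L U n c,
   (forall s, B s -> U s -> derive_in B c s = unit_velocity (tau s)) &
   (forall k, (2 <= k <= n.-1)%N -> derive_inn B k c s0 = 0) /\
   derive_inn B n c s0 = (enorm x0)^-1 ^+ n *:
     (gn - (dotp gn x0 / enorm x0 ^+ 2) *: x0)].
Proof.
move=> Bs0 [n2 /Cn_on_near[U [oU Ux h]] _ g0]; have At0 := (tauP _ Bs0).1.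
case: n n2 h g0 => [|[|n]]//= _ h g0.
(* the condition is relative to B because tau is continuous on B only *)
pose U' := (fun s => B s -> U (tau s))°.
have oU' : open U' by exact: open_interior.
have U's0 : U' s0.
  have := tauC s0 Bs0 _ (open_nbhs_nbhs (conj oU Ux)).
  by rewrite /U' /interior.
have UU s : B s -> U' s -> U (tau s) by move=> Bs /interior_subset; apply.
have hc := Cn_on_arc_param oU oU' UU h.
have gc s : B s -> U' s -> continuous_in_at A gamma' (tau s).
  move=> Bs /(UU _ Bs) Us.
  exact: (Cn_on_continuous h (tauP _ Bs).1 Us (isT : (1 <= n.+2)%N)).
have c' s : B s -> U' s -> derive_in B c s = unit_velocity (tau s).
  by move=> Bs Us; exact: (derive_arc_param s Bs (gc s Bs Us)).2.
exists U'; split => //.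
have := velocity_peano oU At0 Ux h g0.
move=> /(unit_velocity_asymp _ _ _ At0 (gc _ Bs0 U's0)) asy.
set x0 := gamma' (tau s0) in asy *; set r0 := enorm x0 in asy *.
have r00 : 0 < r0 by exact: enorm_velocity_gt0.
have dtau : der_in B tau s0 r0^-1.
  have := @der_in_chain _ A B idfun sg tau s0 1 r0 Bs0 tauP (tauC s0 Bs0).
  rewrite mulr1; apply; first exact: sgD _ (gc _ Bs0 U's0).
    by rewrite gt_eqF.
  exact: der_in_id.
have asc : ((s - s0) ^+ n.+1)^-1 *: (derive_in B c s - derive_in B c s0)
    @[s --> within B s0^'] --> r0^-1 ^+ n.+1 *: (r0^-1 *: (
    (n.+1)`!%:R^-1 *: derive_inn A n.+2 gamma (tau s0) -
    (dotp ((n.+1)`!%:R^-1 *: derive_inn A n.+2 gamma (tau s0)) x0 / r0 ^+ 2) *: x0)).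
  have tc := cvg_dwithin_comp sg tau Bs0 tauP (tauC s0 Bs0).
  exact: (velocity_asymp_chain oU' Bs0 U's0 c' dtau (cvg_comp _ _ tc asy)).
have [c0 cn] := velocity_peano_unique hL oU' Bs0 U's0 hc asc.
split; first exact: c0.
apply: (etrans cn); apply: scale_projection.
by rewrite pnatr_eq0 -lt0n fact_gt0.
Qed.

End Reparametrization.

(** * Convergence in the projective plane *)

Section ProjectivePlane.
Context {R : realType}.
Implicit Types (u v : 'rV[R]_3).

Lemma dRP2_rp2 u v : enorm u = 1 -> enorm v = 1 ->
  dRP2 (rp2 u) (rp2 v) = Num.min (acos (dotp u v)) (acos (- dotp u v)).
Proof.
by move=> u1 v1; rewrite /rp2 dRP2_pi !val_insubd u1 v1 eqxx /dS2 dotpNr.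
Qed.

Lemma dRP2_rp2_bound u v : enorm u = 1 -> enorm v = 1 ->
  0 <= dRP2 (rp2 u) (rp2 v) <= acos `|dotp u v|.
Proof.
move=> u1 v1; have := norm_dotp_le1 u v u1 v1; rewrite dRP2_rp2// => uv.
have /andP[uv1 uv2] : -1 <= dotp u v <= 1 by rewrite -ler_norml.
apply/andP; split; first by rewrite le_min !acos_ge0 ?uv1 ?uv2// lerN2 uv2 lerNl uv1.
by rewrite ge_min; case: ger0P => _; rewrite lexx ?orbT.
Qed.

(** Continuity of the arc cosine at 1 from the left, which comes from the
    monotonicity of the cosine on [0, pi]. *)
Lemma acos_cvg0 {T} {F : set_system T} {FF : Filter F} (h : T -> R) :
  (\forall x \near F, 0 <= h x <= 1) ->
  h x @[x --> F] --> (1 : R) -> acos (h x) @[x --> F] --> (0 : R).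
Proof.
move=> h1 hc; apply/cvgrPdist_lt => e e0.
(* capped at 1 so as to lie in [0, pi], where the cosine decreases *)
pose e' := Num.min e 1; have e'0 : 0 < e' by rewrite lt_min e0 ltr01.
have e'pi : e' <= pi.
  by have p2 := @pi_ge2 R; rewrite ge_min; apply/orP; right; lra.
have ce : cos e' < 1.
  by rewrite -(@cos0 R) ltr_cos// in_itv /= ?lexx ?pi_ge0// ltW.
have hce : \forall x \near F, cos e' < h x.
  have c1 : 0 < 1 - cos e' by rewrite subr_gt0.
  move/cvgrPdist_lt : hc => /(_ _ c1); apply: filterS => x.
  by move=> /(le_lt_trans (ler_norm _)); rewrite ltrD2l ltrN2.
apply: filterS2 h1 hce => x /andP[hx0 hx1] hx.
have hx1' : -1 <= h x <= 1 by rewrite hx1 (le_trans _ hx0)// lerN10.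
rewrite sub0r normrN ger0_norm ?acos_ge0//.
apply: (@lt_le_trans _ _ e'); last by rewrite ge_min lexx.
rewrite -ltr_cos ?acosK// in_itv /= ?(ltW e'0)// ?acos_ge0// acos_lepi//.
Qed.

(** A family of unit vectors converges in the projective plane as soon as some
    multiples of them converge to a nonzero vector.  The factor r s may change
    sign at s0: only |<x s, x s0>| enters the bound on the distance, and it equals
    |<r s x s, x s0>| / |r s x s|. *)
Lemma rp2_continuous_at {D : set R} {x : R -> 'rV[R]_3} {s0 : R} {r : R -> R}
    {k : R} : D s0 -> (forall s, D s -> enorm (x s) = 1) -> k != 0 ->
  (\forall s \near within D s0^', r s != 0) ->
  r s *: x s @[s --> within D s0^'] --> k *: x s0 ->
  dRP2 (rp2 (x s)) (rp2 (x s0)) @[s --> within D (nbhs s0)] --> (0 : R).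
Proof.
move=> Ds0 x1 k0 r0 rx.
have d0 : dRP2 (rp2 (x s0)) (rp2 (x s0)) = 0.
  apply/eqP; rewrite eq_le andbC.
  have := dRP2_rp2_bound _ _ (x1 _ Ds0) (x1 _ Ds0).
  by rewrite -sqr_enorm x1// expr1n normr1 acos1.
rewrite -[X in _ --> X]d0; apply: cvg_within_pt => //; rewrite d0.
have nd : `|dotp (x s) (x s0)| @[s --> within D s0^'] --> (1 : R).
  have h : `|dotp (r s *: x s) (x s0)| * (enorm (r s *: x s))^-1
      @[s --> within D s0^'] -->
      `|dotp (k *: x s0) (x s0)| * (enorm (k *: x s0))^-1.
    apply: cvgM; first by apply: cvg_norm; apply: cvg_dotp => //; exact: cvg_cst.
    apply: cvgV; last exact: cvg_enorm.
    by rewrite enormZ x1// mulr1 normr_eq0.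
  move: h; rewrite dotpZl -sqr_enorm enormZ x1// expr1n !mulr1 divff ?normr_eq0//.
  apply: cvg_trans; apply: near_eq_cvg.
  apply: filterS2 r0 (near_dwithinT D s0) => s rs0 [Ds _].
  by rewrite dotpZl enormZ x1// mulr1 normrM mulrC mulKf// normr_eq0.
have bd : \forall s \near within D s0^', 0 <= `|dotp (x s) (x s0)| <= 1.
  apply: filterS (near_dwithinT D s0) => s [Ds _].
  by rewrite normr_ge0 norm_dotp_le1 ?x1.
apply: (squeeze_cvgr _ (@cvg_cst _ (0 : R) _ _ _) (acos_cvg0 _ bd nd)).
apply: filterS (near_dwithinT D s0) => s [Ds _].
by apply: dRP2_rp2_bound; exact: x1.
Qed.

End ProjectivePlane.

(** * The integral of a positive function and its inverse *)

Section Primitive.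
Context {R : realType} {a b : R} (hab : a < b) (f : R -> R).
Local Notation A := (`[a, b]%classic : set R).
Local Notation mu := (@lebesgue_measure R).
Hypothesis fint : mu.-integrable A (EFin \o f).
Hypothesis f_gt0 : forall t, A t -> 0 < f t.

Definition primitive t : R := Rintegral mu `[a, t] f.
Local Notation F := primitive.
Local Notation L := (F b).
Definition primitive_inv : R -> R := 'pinv_(fun=> a) `[a, b] F.
Local Notation G := primitive_inv.

Lemma itvoc_sub u v : a <= u -> v <= b -> `]u, v] `<=` A.
Proof.
move=> au vb x; rewrite /= !in_itv /= => /andP[ux xv].
by rewrite (le_trans au (ltW ux)) (le_trans xv).
Qed.

Lemma primitiveB u v : a <= u -> u <= v -> v <= b ->
  F v - F u = Rintegral mu `]u, v] f.
Proof.
move=> au uv vb; apply: Rintegral_itvB => //.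
by apply: integrableS fint => //; apply: subset_itvl; rewrite bnd_simp.
Qed.

Lemma integrable_itvoc u v : a <= u -> v <= b ->
  mu.-integrable `]u, v] (EFin \o f).
Proof. by move=> au vb; apply: integrableS fint => //; exact: itvoc_sub. Qed.

Lemma Rintegral_cst_itvoc (u v r : R) : u <= v ->
  Rintegral mu `]u, v] (fun=> r) = r * (v - u).
Proof.
move=> uv; rewrite Rintegral_cst//= lebesgue_measure_itv /= lte_fin.
case: ltP => //= vu; have -> : u = v by apply/le_anti/andP; split.
by rewrite subrr.
Qed.

Lemma integrable_cst_itvoc (u v r : R) : mu.-integrable `]u, v] (EFin \o fun=> r).
Proof.
apply/integrableP; split; first exact: measurable_cst.
rewrite integral_cst//= lebesgue_measure_itv /=; case: ifP => _.
  by rewrite -EFinB -EFinM ltry.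
by rewrite mule0 ltry.
Qed.

Lemma primitive_bound u v lo hi : a <= u -> u <= v -> v <= b ->
  (forall x, u < x <= v -> lo <= f x <= hi) ->
  lo * (v - u) <= F v - F u <= hi * (v - u).
Proof.
move=> au uv vb fb; rewrite primitiveB// -!Rintegral_cst_itvoc//.
have fi := integrable_itvoc u v au vb.
by apply/andP; split; apply: le_Rintegral => //;
  [exact: integrable_cst_itvoc| |exact: integrable_cst_itvoc|];
  move=> x; rewrite /= in_itv /= => /fb /andP[].
Qed.

(** A positive function with zero integral would vanish almost everywhere, so
    the interval ]u, v] would be negligible. *)
Lemma primitive_increasing u v : a <= u -> u < v -> v <= b -> F u < F v.
Proof.
move=> au uv vb; rewrite -subr_gt0 primitiveB ?(ltW uv)//.
have fi := integrable_itvoc u v au vb; have fA := itvoc_sub u v au vb.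
rewrite lt_neqAle Rintegral_ge0 ?andbT; last by move=> x /fA /f_gt0/ltW.
apply/eqP => /esym F0.
have mf := measurable_int mu fi.
have i0 : (\int[mu]_(x in `]u, v]) `|(EFin \o f) x|)%E = 0%E.
  have -> : (\int[mu]_(x in `]u, v]) `|(EFin \o f) x|)%E =
            (\int[mu]_(x in `]u, v]) (EFin \o f) x)%E.
    apply: eq_integral => x /set_mem /fA /f_gt0 fx /=.
    by rewrite ger0_norm// ltW.
  move: F0; rewrite /Rintegral => /eqP; rewrite fine_eq0; first by move/eqP.
  exact: integrable_fin_num.
have /(ae_eq_integral_abs mu (measurable_itv _) mf) [N [mN N0 sN]] := i0.
have : (mu `]u, v] <= mu N)%E.
  apply: le_measure; rewrite ?inE// => x uvx; apply: sN => /= /(_ uvx) [].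
  by apply/eqP; rewrite gt_eqF// f_gt0//; exact: fA.
rewrite N0 lebesgue_measure_itv /= lte_fin uv -EFinB lee_fin.
by rewrite leNgt subr_gt0 uv.
Qed.

Lemma primitive_lt : {in `[a, b] &, {mono F : x y / x < y}}.
Proof.
move=> x y; rewrite !in_itv /= => /andP[ax xb] /andP[ay yb].
have [xy|yx|->] := ltgtP x y; last by rewrite ltxx.
  by rewrite primitive_increasing.
by apply/negbTE; rewrite -leNgt ltW// primitive_increasing.
Qed.

Lemma primitive_le : {in `[a, b] &, {mono F : x y / x <= y}}.
Proof. by move=> x y xA yA; rewrite leNgt primitive_lt// leNgt. Qed.

Lemma left_endpoint_mem : a \in `[a, b]. Proof. by rewrite in_itv /= lexx ltW. Qed.
Lemma right_endpoint_mem : b \in `[a, b]. Proof. by rewrite in_itv /= lexx ltW. Qed.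

Lemma primitive_a : F a = 0.
Proof. by rewrite /F set_itv1 Rintegral_set1. Qed.

Lemma primitive_total_gt0 : 0 < L.
Proof. by rewrite -primitive_a primitive_lt ?left_endpoint_mem ?right_endpoint_mem. Qed.

Lemma primitive_bij : set_bij `[a, b] `[0, L] F.
Proof.
split.
- move=> x Ax; rewrite /= in_itv /= -{1}primitive_a.
  by rewrite !primitive_le ?left_endpoint_mem ?right_endpoint_mem.
- move=> x y /set_mem xA /set_mem yA e.
  by apply: (inc_inj_in primitive_le).
move=> y; rewrite /= in_itv /= => /andP[y0 yL].
have [x xab <-] : exists2 x, x \in `[a, b] & F x = y.
  apply: IVT; first exact: ltW.
    exact: (@parameterized_integral_continuous R a b f (ltW hab) fint).
  by rewrite primitive_a ge_min y0 le_max yL orbT.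
by exists x.
Qed.

Lemma primitive_invP s : s \in `[0, L] -> A (G s) /\ F (G s) = s.
Proof.
have [_ _ surj] := primitive_bij; move=> sL; split.
  by apply: (surjpinv_image_sub surj); exists s.
by apply: (surjpK _ surj); rewrite inE.
Qed.

Lemma primitiveK t : A t -> G (F t) = t.
Proof.
have [_ inj _] := primitive_bij; move=> At.
by apply: (pinvKV _ inj); rewrite inE.
Qed.

Lemma primitive_mem t : A t -> F t \in `[0, L].
Proof. by have [h _ _] := primitive_bij => /h. Qed.

Lemma primitive_inv_continuous s : s \in `[0, L] ->
  G y @[y --> within `[0, L] (nbhs s)] --> G s.
Proof.
have GF : {within `[0, L], continuous G}.
  apply: segment_inc_surj_continuous.
    move=> x y /primitive_invP[Ax Fx] /primitive_invP[Ay Fy].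
    by rewrite -{2}Fx -{2}Fy primitive_le.
  have L0 := ltW primitive_total_gt0.
  rewrite -primitive_a !primitiveK; [|exact: right_endpoint_mem|exact: left_endpoint_mem].
  move=> t At; exists (F t); last exact: primitiveK.
  by rewrite primitive_a; exact: primitive_mem.
by move=> sL; have /subspace_continuousP := GF; apply.
Qed.

(** Continuity of f at the single point t0 suffices, since f is within e of
    f t0 on all short intervals ending at t0. *)
Lemma primitive_der t0 : A t0 ->
  f t @[t --> within A (nbhs t0)] --> f t0 -> der_in A F t0 (f t0).
Proof.
move=> At0 fc; apply/cvgrPdist_le => e e0.
move/cvgrPdist_le : fc => /(_ e e0) fc.
have /dwithin_ball[r r0 rP] := near_dwithin _ _ _ fc.
apply: (ball_dwithin r) => // t At tt0 t0t.
have bd u v : A u -> A v -> u <= v -> `|t0 - u| < r -> `|t0 - v| < r ->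
    `|f t0 * (v - u) - (F v - F u)| <= e * (v - u).
  rewrite /= !in_itv /= => /andP[au ub] /andP[av vb] uv ur vr.
  have /andP[h1 h2] : (f t0 - e) * (v - u) <= F v - F u <= (f t0 + e) * (v - u).
    apply: primitive_bound => // x /andP[ux xv].
    have xr : `|t0 - x| < r.
      move: ur vr; rewrite !ltr_norml => /andP[? ?] /andP[? ?]; lra.
    have : `|f t0 - f x| <= e.
      have [->|xt0] := eqVneq x t0; first by rewrite subrr normr0 ltW.
      apply: rP => //; rewrite /= in_itv /=; lra.
    by rewrite ler_norml => /andP[? ?]; apply/andP; split; lra.
  by rewrite ler_norml; apply/andP; split; lra.
have r00 : `|t0 - t0| < r by rewrite subrr normr0.
have d0 : 0 < `|t - t0| by rewrite normr_gt0 subr_eq0.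
have key : `|f t0 * (t - t0) - (F t - F t0)| <= e * `|t - t0|.
  have [tlt|tgt] := leP t0 t.
    by rewrite (ger0_norm (_ : 0 <= t - t0)) ?subr_ge0//; exact: bd.
  have := bd t t0 At At0 (ltW tgt) t0t r00.
  by rewrite distrC (distrC t) (gtr0_norm (_ : 0 < t0 - t)) ?subr_gt0//;
    congr (`|_| <= _); ring.
rewrite -(ler_pM2r d0) -normrM mulrBl.
have -> : (t - t0)^-1 * (F t - F t0) * (t - t0) = F t - F t0.
  by rewrite mulrAC mulVf ?mul1r// subr_eq0.
exact: key.
Qed.

End Primitive.

(** * The Frenet frame *)

Section FrameAlgebra.
Context {R : realType}.
Implicit Types (x u v w : 'rV[R]_3).

Lemma projection_orthogonal (k : R) x u : x != 0 ->
  dotp ((enorm x)^-1 *: x) (k *: (u - (dotp u x / enorm x ^+ 2) *: x)) = 0.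
Proof.
move=> /enorm_gt0 x0; rewrite dotpZl dotpZr dotpC dotpBl dotpZl sqr_enorm divfK.
  by rewrite subrr !mulr0.
by rewrite -sqr_enorm expf_neq0// gt_eqF.
Qed.

Lemma projection_neq0 (k l : R) x u : k != 0 -> cross x u <> 0 ->
  k *: (u - l *: x) != 0.
Proof.
move=> k0 xu; apply/eqP => /eqP; rewrite scaler_eq0 (negPf k0) /= => /eqP e.
apply: xu; rewrite -(crossBZ l x u) e.
by have := crossZr 0 x 0; rewrite !scale0r.
Qed.

Lemma frame_algebra u v : enorm u = 1 -> v != 0 -> dotp u v = 0 ->
  let b := (enorm v)^-1 *: cross u v in
  cross b u = (enorm v)^-1 *: v /\ orthonormal3 u b (cross b u).
Proof.
move=> u1 v0 uv b; have e : cross b u = (enorm v)^-1 *: v.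
  by rewrite /b crossZl crossK -sqr_enorm u1 uv expr1n scale1r scale0r subr0.
split => //; rewrite e; split; split => //.
- by rewrite /b enormZ enorm_cross// u1 mul1r -enormZ enorm_normalize.
- exact: enorm_normalize.
- by rewrite /b dotpZr dotp_crossl mulr0.
- by rewrite /b dotpZl dotpZr dotp_crossr !mulr0.
- by rewrite dotpZr uv mulr0.
Qed.

End FrameAlgebra.

Section FrameLimit.
Context {R : realType}.

Lemma cvg_dwithin_sub {T : topologicalType} {D B : set R} {s0 : R} {f : R -> T}
    {l : T} : (forall s, D s -> B s) ->
  f s @[s --> within B s0^'] --> l -> f s @[s --> within D s0^'] --> l.
Proof. by move=> DB; apply: cvg_trans; apply: cvg_app; exact: within_subset. Qed.

(** Here x, y and q stand for c', c'' and c^(n)(s0).  Away from s0 the frame is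
    given by x and y; multiplied by |y s| / (s - s0)^k, both of its vectors
    converge to positive multiples of their values at s0. *)
Lemma rp2_frame_limit {B D : set R} {x y b n : R -> 'rV[R]_3} {s0 : R}
    {q : 'rV[R]_3} {k : nat} :
  (forall s, D s -> B s) -> D s0 ->
  (forall s, D s -> enorm (b s) = 1) -> (forall s, D s -> enorm (n s) = 1) ->
  (forall s, D s -> y s <> 0 ->
     b s = (enorm (y s))^-1 *: cross (x s) (y s) /\
     n s = (enorm (y s))^-1 *: y s) ->
  b s0 = (enorm q)^-1 *: cross (x s0) q -> n s0 = (enorm q)^-1 *: q ->
  q != 0 -> x s @[s --> within B (nbhs s0)] --> x s0 ->
  ((s - s0) ^+ k)^-1 *: y s @[s --> within B s0^'] --> k`!%:R^-1 *: q ->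
  (\forall s \near within B s0^', y s <> 0) ->
  dRP2 (rp2 (b s)) (rp2 (b s0)) @[s --> within D (nbhs s0)] --> (0 : R) /\
  dRP2 (rp2 (n s)) (rp2 (n s0)) @[s --> within D (nbhs s0)] --> (0 : R).
Proof.
move=> DB Ds0 b1 n1 gen bE nE q0 xc yc ynz.
have q_gt0 : enorm q != 0 by rewrite gt_eqF// enorm_gt0.
have l0 : k`!%:R^-1 * enorm q != 0.
  by rewrite mulf_neq0// invr_eq0 pnatr_eq0 -lt0n fact_gt0.
have Dnz : \forall s \near within D s0^', [/\ D s, s != s0 & y s != 0].
  have nD : \forall s \near within D s0^', y s <> 0.
    by apply: (within_subset _ DB); exact: ynz.
  apply: filterS2 nD (near_dwithinT D s0) => s /eqP ys [Ds ss0].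
  by split.
pose r s := ((s - s0) ^+ k)^-1 * enorm (y s).
have r0 : \forall s \near within D s0^', r s != 0.
  apply: filterS Dnz => s [_ ss0 ys].
  by rewrite mulf_neq0 ?invr_eq0 ?expf_neq0 ?subr_eq0// gt_eqF// enorm_gt0.
have yD := cvg_dwithin_sub DB yc.
have xD := cvg_dwithin_sub DB (cvg_dwithin _ _ _ _ _ xc).
have rK s (z : 'rV[R]_3) : y s != 0 ->
    r s *: ((enorm (y s))^-1 *: z) = ((s - s0) ^+ k)^-1 *: z.
  by move=> ys; rewrite scalerA mulfK// gt_eqF// enorm_gt0.
have lK (z : 'rV[R]_3) :
    (k`!%:R^-1 * enorm q) *: ((enorm q)^-1 *: z) = k`!%:R^-1 *: z.
  by rewrite scalerA mulfK.
split; apply: (rp2_continuous_at Ds0 _ l0 r0) => //.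
  rewrite bE lK -crossZr; apply: cvg_trans (cvg_cross _ _ _ _ xD yD).
  apply: near_eq_cvg; apply: filterS Dnz => s [Ds ss0 ys].
  by rewrite (gen s Ds (elimN eqP ys)).1 rK// crossZr.
rewrite nE lK; apply: cvg_trans yD.
apply: near_eq_cvg; apply: filterS Dnz => s [Ds ss0 ys].
by rewrite (gen s Ds (elimN eqP ys)).2 rK.
Qed.

End FrameLimit.

Section Order.
Context {R : realType} {a b : R} {gamma : R -> 'rV[R]_3}.

Lemma order_at_unique t n m :
  order_at a b gamma t n -> order_at a b gamma t m -> n = m.
Proof.
move=> [n2 _ gn0 gn] [m2 _ gm0 gm]; have [nm|mn|//] := ltngtP n m.
  by case: gn0; apply: gm; rewrite n2 -ltnS prednK// (leq_trans _ m2).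
by case: gm0; apply: gn; rewrite m2 -ltnS prednK// (leq_trans _ n2).
Qed.

Lemma order_of_eq t n : order_at a b gamma t n -> order_of a b gamma t = n.
Proof.
move=> tn; apply: (order_at_unique t) => //.
by apply: (@xgetPex _ 0%N [set n | order_at a b gamma t n]); exists n.
Qed.

End Order.

Section Frenet.
Context {R : realType} {a b : R} (hab : a < b) {gamma : R -> 'rV[R]_3}.
Local Notation A := (`[a, b]%classic : set R).
Local Notation L := (curve_length a b gamma).
Local Notation B := (`[0, L]%classic : set R).
Local Notation gamma' := (derive_in A gamma).
Local Notation sg := (arclen a b gamma).
Local Notation tau := (arclen_inv a b gamma).
Local Notation c := (arc_param a b gamma).
Local Notation mu := (@lebesgue_measure R).
Hypothesis hreg : forall t, A t -> derivable_in A gamma t /\ gamma' t <> 0.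
Hypothesis hlen : mu.-integrable A (EFin \o speed a b gamma).

Lemma speed_gt0 t : A t -> 0 < speed a b gamma t.
Proof. exact: enorm_velocity_gt0. Qed.

Lemma arclen_invP s : B s -> A (tau s) /\ sg (tau s) = s.
Proof. exact: (primitive_invP hab _ hlen speed_gt0). Qed.

Lemma arclenK t : A t -> tau (sg t) = t.
Proof. exact: (primitiveK hab _ hlen speed_gt0). Qed.

Lemma arclen_inv_continuous s : B s ->
  tau y @[y --> within B (nbhs s)] --> tau s.
Proof. exact: (primitive_inv_continuous hab _ hlen speed_gt0). Qed.

Lemma arclen_der t : A t -> continuous_in_at A gamma' t ->
  der_in A sg t (enorm (gamma' t)).
Proof.
move=> At gc; apply: (primitive_der _ hlen t At).
exact: cvg_enorm gc.
Qed.

Lemma curve_length_gt0 : 0 < L.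
Proof. exact: (primitive_total_gt0 hab _ hlen speed_gt0). Qed.

Lemma tangent_arclen t : A t -> continuous_in_at A gamma' t ->
  derivable_in B c (sg t) /\ derive_in B c (sg t) = @unit_velocity R a b gamma t.
Proof.
move=> At gc; have Bs : B (sg t) by exact: (primitive_mem hab _ hlen speed_gt0).
have := derive_arc_param curve_length_gt0 gamma sg tau hreg arclen_invP
  arclen_inv_continuous arclen_der (sg t) Bs.
by rewrite arclenK//; apply.
Qed.

Definition arclen_order := reparam_order hab curve_length_gt0 gamma sg tau hreg arclen_invP
  arclen_inv_continuous arclen_der.

Lemma frenet_frame s0 n : B s0 -> order_at a b gamma (tau s0) n ->
  nonparallel_at a b gamma (tau s0) n ->
  let cn := derive_inn B n c s0 in
  [/\ Cn_near B n c s0 /\ cn <> 0,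
      binormal a b gamma s0 = (enorm cn)^-1 *: cross (derive_in B c s0) cn,
      normal a b gamma s0 = (enorm cn)^-1 *: cn &
      orthonormal3 (tangent a b gamma s0) (binormal a b gamma s0)
        (normal a b gamma s0)].
Proof.
move=> Bs0 on np cn.
have [U [oU Us0 hc c'] [_ cnE]] := arclen_order s0 n Bs0 on.
have At0 := (arclen_invP s0 Bs0).1.
have x0 : gamma' (tau s0) != 0 by apply/eqP; exact: (hreg _ At0).2.
have T1 : enorm (derive_in B c s0) = 1.
  by rewrite c'//; exact: enorm_unit_velocity.
have cn0 : cn != 0.
  rewrite /cn cnE; apply: projection_neq0 => //.
  by rewrite expf_neq0// invr_eq0 gt_eqF// enorm_gt0.
have Tcn : dotp (derive_in B c s0) cn = 0.
  by rewrite /cn cnE c'//; exact: projection_orthogonal.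
have bE : binormal a b gamma s0 = (enorm cn)^-1 *: cross (derive_in B c s0) cn.
  by rewrite /binormal (order_of_eq _ _ on).
have [nE on3] := frame_algebra _ _ T1 cn0 Tcn.
rewrite -bE in nE on3; split => //.
by split; [apply/Cn_on_near; exists U|exact/eqP].
Qed.

Lemma arc_derive2_eq0 s0 n : B s0 -> order_at a b gamma (tau s0) n -> (2 < n)%N ->
  derive_inn B 2 c s0 = 0.
Proof.
move=> Bs0 on n2; have [U [_ _ _ _] [c0 _]] := arclen_order s0 n Bs0 on.
by apply: c0; rewrite /= -ltnS prednK// (leq_trans _ n2).
Qed.

(** At a point of order greater than 2 the second derivative of c vanishes, by
    [arc_derive2_eq0]. *)
Lemma order_eq2 s0 n : B s0 -> order_at a b gamma (tau s0) n ->
  derive_inn B 2 c s0 <> 0 -> n = 2%N.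
Proof.
move=> Bs0 on c2; have [n2 _ _ _] := on; apply/eqP; rewrite eqn_leq n2 andbT.
by rewrite leqNgt; apply/negP => /(arc_derive2_eq0 _ _ Bs0 on).
Qed.

Lemma arc_asymptotics s0 k : B s0 -> order_at a b gamma (tau s0) k.+2 ->
  nonparallel_at a b gamma (tau s0) k.+2 ->
  let cn := derive_inn B k.+2 c s0 in
  [/\ continuous_in_at B (derive_in B c) s0,
    ((s - s0) ^+ k)^-1 *: derive_inn B 2 c s
      @[s --> within B s0^'] --> k`!%:R^-1 *: cn &
    \forall s \near within B s0^', derive_inn B 2 c s <> 0].
Proof.
move=> Bs0 on np cn; have [[_ /eqP cn0] _ _ _] := frenet_frame s0 k.+2 Bs0 on np.
have [U [oU Us0 hc c'] [c0 cnE]] := arclen_order s0 k.+2 Bs0 on.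
have asy := acceleration_peano oU Bs0 Us0 hc c0.
have cc := Cn_on_continuous hc Bs0 Us0 (isT : (1 <= k.+2)%N).
split; [exact: cc|exact: asy|].
have l0 : k`!%:R^-1 *: cn != 0.
  by rewrite scaler_eq0 negb_or cn0 invr_eq0 pnatr_eq0 -lt0n fact_gt0.
apply: filterS (cvgr_neq0 _ asy l0) => s sc e.
by case/eqP: sc; rewrite e scaler0.
Qed.

Lemma arclen_inv_oo s : s \in `]0, L[ -> B s /\ tau s \in `]a, b[.
Proof.
rewrite in_itv /= => /andP[s0 sL]; have Bs : B s by rewrite /= in_itv /= !ltW.
split => //; have [] := arclen_invP s Bs; rewrite /= !in_itv /=.
move=> /andP[at_ tb] e; rewrite !lt_neqAle at_ tb !andbT; apply/andP; split.
  apply: contraTneq s0 => ta; rewrite -e -ta -leNgt.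
  by rewrite [X in X <= _](primitive_a (speed a b gamma)).
by apply: contraTneq sL => tb'; rewrite -e tb' ltxx.
Qed.

Hypothesis hord :
  forall t, t \in `]a, b[ -> exists n, order_at a b gamma t n.
Hypothesis hnonpar : forall t n, t \in `]a, b[ -> order_at a b gamma t n ->
  nonparallel_at a b gamma t n.

Lemma frenet_dom_oo : `]0, L[ `<=` frenet_dom a b gamma.
Proof.
move=> s /arclen_inv_oo[Bs ts]; split => //; have [n tn] := hord _ ts.
by exists n; split => //; exact: hnonpar.
Qed.

Lemma frenet_dom_asymptotics s0 : frenet_dom a b gamma s0 ->
  exists k, order_at a b gamma (tau s0) k.+2 /\
    nonparallel_at a b gamma (tau s0) k.+2.
Proof.
move=> [Bs0 [n [on np]]]; have [n2 _ _ _] := on.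
by case: n n2 on np => [|[|k]]// _ on np; exists k.
Qed.

(** By [arc_asymptotics] the zeros in ]0, L[ are isolated points of the set of
    zeros. *)
Lemma countable_arc_zeros :
  countable [set s0 | s0 \in `[0, L] /\ derive_inn B 2 c s0 = 0].
Proof.
set Z := [set _ | _].
have ZI : Z `<=` isolated Z `|` [set 0; L].
  move=> s0 [Bs0 c0].
  (* no order is assumed at the endpoints, which may be accumulated by zeros *)
  have [->|s00] := eqVneq s0 0; first by right; left.
  have [->|s0L] := eqVneq s0 L; first by right; right.
  left; have s0oo : s0 \in `]0, L[.
    move: Bs0; rewrite !in_itv /= => /andP[? ?].
    by rewrite !lt_neqAle eq_sym s00 s0L; apply/andP.
  have [k [on np]] := frenet_dom_asymptotics _ (frenet_dom_oo s0 s0oo).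
  have [_ _ nz] := arc_asymptotics s0 k Bs0 on np.
  split; first by rewrite inE.
  have nz' : nbhs s0 (fun s => s != s0 -> B s -> derive_inn B 2 c s <> 0) := nz.
  exists (fun s => s != s0 -> B s -> derive_inn B 2 c s <> 0) => //.
  apply/seteqP; split=> [s [h [Bs cs]]|s ->].
    by have [//|ss0] := eqVneq s s0; case: (h ss0 Bs).
  by split => //; rewrite eqxx.
have Zc : countable
    (\bigcup_(i in [set: bool]) if i then isolated Z else [set 0; L]).
  apply: bigcup_countable => [|[] _]; first exact: countableP.
    exact: countable_isolated.
  by apply: finite_set_countable; exact: finite_set2.
apply: sub_countable Zc; apply: subset_card_le => s /ZI[Zs|Zs].
  by exists true.
by exists false.
Qed.

Lemma rp2_frame_continuous :
  rp2_continuous_on (frenet_dom a b gamma)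
    (fun s => rp2 (binormal a b gamma s)) /\
  rp2_continuous_on (frenet_dom a b gamma)
    (fun s => rp2 (normal a b gamma s)).
Proof.
set D := frenet_dom a b gamma.
have unit_b s : D s -> enorm (binormal a b gamma s) = 1.
  move=> Ds; have [k [on np]] := frenet_dom_asymptotics _ Ds.
  by have [_ _ _ [[]]] := frenet_frame s _ Ds.1 on np.
have unit_n s : D s -> enorm (normal a b gamma s) = 1.
  move=> Ds; have [k [on np]] := frenet_dom_asymptotics _ Ds.
  by have [_ _ _ [[]]] := frenet_frame s _ Ds.1 on np.
have generic s : D s -> derive_inn B 2 c s <> 0 ->
    binormal a b gamma s = (enorm (derive_inn B 2 c s))^-1 *:
      cross (derive_in B c s) (derive_inn B 2 c s) /\
    normal a b gamma s =
      (enorm (derive_inn B 2 c s))^-1 *: derive_inn B 2 c s.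
  move=> [Bs [n [on np]]] c2; have n2 := order_eq2 s n Bs on c2.
  by rewrite n2 in on np; have [_ bE nE _] := frenet_frame s 2 Bs on np.
have main s0 : D s0 ->
    dRP2 (rp2 (binormal a b gamma s)) (rp2 (binormal a b gamma s0))
      @[s --> within D (nbhs s0)] --> (0 : R) /\
    dRP2 (rp2 (normal a b gamma s)) (rp2 (normal a b gamma s0))
      @[s --> within D (nbhs s0)] --> (0 : R).
  move=> Ds0; have Bs0 := Ds0.1.
  have [k [on np]] := frenet_dom_asymptotics _ Ds0.
  have [[_ /eqP cn0] bE nE _] := frenet_frame s0 _ Bs0 on np.
  have [c'c asy nz] := arc_asymptotics s0 k Bs0 on np.
  have DB s : D s -> B s by case.
  exact: (rp2_frame_limit DB Ds0 unit_b unit_n generic bE nE cn0 c'c asy nz).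
by split=> s0 Ds0; [exact: (main s0 Ds0).1|exact: (main s0 Ds0).2].
Qed.

End Frenet.

Theorem proposition6p1 (R : realType) (a b : R) (gamma : R -> 'rV[R]_3)
    (hab : a < b)
    (hreg : forall t, t \in `[a, b] ->
       derivable_in `[a, b] gamma t /\ derive_in `[a, b] gamma t <> 0)
    (hlen : lebesgue_measure.-integrable `[a, b] (EFin \o speed a b gamma))
    (hord : forall t0, t0 \in `]a, b[ -> exists n, order_at a b gamma t0 n)
    (hnonpar : forall t0 n, t0 \in `]a, b[ -> order_at a b gamma t0 n ->
       nonparallel_at a b gamma t0 n) :
  let L := curve_length a b gamma in
  let c := arc_param a b gamma in
  let s := arclen a b gamma in
  [/\ (* s is invertible, from [a, b] onto [0, L] *)
      set_bij `[a, b] `[0, L] s,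
      (* the tangent, also at endpoints without an order *)
      (forall t0, t0 \in `[a, b] ->
         continuous_in_at `[a, b] (derive_in `[a, b] gamma) t0 ->
         derivable_in `[0, L] c (s t0) /\
         tangent a b gamma (s t0) = derive_in `[0, L] c (s t0) /\
         enorm (tangent a b gamma (s t0)) = 1),
      (* the Frenet-Serret frame *)
      (forall s0 t0 n, s0 \in `[0, L] -> t0 \in `[a, b] -> s0 = s t0 ->
         order_at a b gamma t0 n -> nonparallel_at a b gamma t0 n ->
         let cn := derive_inn `[0, L] n c s0 in
         [/\ Cn_near `[0, L] n c s0 /\ cn <> 0,
             tangent a b gamma s0 = derive_in `[0, L] c s0,
             binormal a b gamma s0 =
               (enorm cn)^-1 *: cross (derive_in `[0, L] c s0) cn,
             normal a b gamma s0 =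
               cross (binormal a b gamma s0) (tangent a b gamma s0) /\
             normal a b gamma s0 = (enorm cn)^-1 *: cn &
             orthonormal3 (tangent a b gamma s0) (binormal a b gamma s0)
               (normal a b gamma s0)]),
      (* the zeros of the second derivative of c, and the normal elsewhere *)
      countable [set s0 | s0 \in `[0, L] /\ derive_inn `[0, L] 2 c s0 = 0] /\
      (forall s0, frenet_dom a b gamma s0 ->
         derive_inn `[0, L] 2 c s0 <> 0 ->
         normal a b gamma s0 =
           (enorm (derive_inn `[0, L] 2 c s0))^-1 *: derive_inn `[0, L] 2 c s0)
      & (* continuity in the projective plane *)
      [/\ `]0, L[ `<=` frenet_dom a b gamma,
          rp2_continuous_on (frenet_dom a b gamma)
            (fun s0 => rp2 (binormal a b gamma s0)) &
          rp2_continuous_on (frenet_dom a b gamma)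
            (fun s0 => rp2 (normal a b gamma s0))]].
Proof.
move=> L c s; have arcP := arclen_invP hab hreg hlen.
split.
- exact: (primitive_bij hab _ hlen (speed_gt0 hreg)).
- move=> t0 At0 gc; have [cd cE] := tangent_arclen hab hreg hlen t0 At0 gc.
  split => //; split => //; rewrite /tangent.
  by apply: (etrans (congr1 _ cE)); exact: enorm_unit_velocity.
- move=> s0 t0 n Bs0 At0 e on np cn.
  have te : arclen_inv a b gamma s0 = t0.
    by rewrite e; exact: (arclenK hab hreg hlen t0 At0).
  rewrite -te in on np.
  by have [] := frenet_frame hab hreg hlen s0 n Bs0 on np.
- split; first exact: (countable_arc_zeros hab hreg hlen hord hnonpar).
  move=> s0 [Bs0 [n [on np]]] c2.
  have n2 := order_eq2 hab hreg hlen s0 n Bs0 on c2; rewrite n2 in on np.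
  by have [] := frenet_frame hab hreg hlen s0 2 Bs0 on np.
have [bc nc] := rp2_frame_continuous hab hreg hlen.
by split => //; exact: (frenet_dom_oo hab hreg hlen hord hnonpar).
Qed.
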